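(* Let $n=r+s$ and let $I=(i_1<\dots<i_r)$, $J=(j_1<\dots<j_s)$ be increasing tuples in $\{1,\dots,n\}$, with $I\cap J=C=(c_1,\dots,c_z)$. Let $N=\mathrm{intc}(I\setminus C)$ be the length of the standard column tower of $I\setminus C$ in the ordered set $(I\cup J)\setminus C$. Then in $\mathcal O_q(M_n(k))$ $$q^{-z}[r+1\dots n,J][1\dots r,I]=\sum_{i=0}^{N}(-1)^i(q^{-1}-q)^i\sum_{(R,R')\in C_i^{I\setminus C}}(-q)^{-l(R)-l(R')}[1\dots r,(R\cup C)_{ord}]\,[r+1\dots n,(R'\cup C)_{ord}],$$ where the lists $C_i^{I\setminus C}$ are formed inside the ordered set $(I\cup J)\setminus C$ (so complements are taken in $(I\cup J)\setminus C$), as defined in the context.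
   Context: Let $k$ be a field, $q$ an indeterminate, $k_q=k[q,q^{-1}]$. $\mathcal O_q(M_n(k))$ is the $k_q$-algebra generated by $x_{ij}$, $1\le i,j\le n$, with relations: $x_{ij}x_{ik}=q^{-1}x_{ik}x_{ij}$ and $x_{ji}x_{ki}=q^{-1}x_{ki}x_{ji}$ for $j<k$; $x_{ij}x_{kl}=x_{kl}x_{ij}$ if $i<k,\ j>l$ or $i>k,\ j<l$; $x_{ij}x_{kl}-x_{kl}x_{ij}=(q^{-1}-q)x_{kj}x_{il}$ if $i<k,\ j<l$. Quantum minors: for increasing tuples $A=(a_1<\dots<a_p)$, $B=(b_1<\dots<b_p)$, $[A,B]=\sum_{\sigma\in S_p}(-q)^{-l(\sigma)}x_{a_1b_{\sigma(1)}}\cdots x_{a_pb_{\sigma(p)}}$, with $l(\sigma)$ the number of inversions. For a tuple $S$ of distinct integers, $l(S)$ is its number of inversions; $(R\cup C)_{ord}$ is the increasing tuple whose set of entries is the union of the entries of $R$ and $C$. Increasing tuples are also regarded as sets. Standard column tower in an ordered set: let $V=\{v_1<\dots<v_m\}$ be a finite set of integers, identified with $\{1,\dots,m\}$ by $v_a\leftrightarrow a$ (so ''adjacent transpositions'', ''$z,z+1$'', etc. refer to consecutive elements of $V$). Let $B=(b_1<\dots<b_p)$ be an increasing tuple in $\{1,\dots,m\}$, $B\ne(m-p+1,\dots,m)$. Put $b_{p+1}=m+1$ and let $a$ be the largest index in $\{1,\dots,p\}$ with $b_{a+1}-b_a>1$; the standard column transposition of $B$ is $\sigma_B=(b_a,\,b_a+1)$.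 Applying successively the standard transpositions one gets the standard column tower $B=B_N<B_{N-1}<\dots<B_0=(m-p+1,\dots,m)$, with $B_{s-1}=\sigma_s(B_s)$, $\sigma_s=\sigma_{B_s}$; its length is $N=\mathrm{intc}(B)$. The lists $C_i^{B_s}$ (finite lists, with multiplicity, of pairs $(R,R')$ of tuples of distinct, not necessarily increasing, elements of $V$): $C_0^{B_0}$ consists of the single pair $(B_0,B_0')$, where $B_0'$ is the increasing complement of $B_0$ in $V$; $C_i^{B_s}$ is empty if $i<0$ or $i>s$; for $1\le s\le N$, $0\le i\le s$, $C_i^{B_s}$ is the concatenation of $C_{i-1}^{B_{s-1}}$ with the members of $\phi_{i-1}^{B_{s-1}}$ removed, and of $\sigma_s(C_i^{B_{s-1}})$. Here $\sigma_s$ acts by applying the transposition to every entry of $R$ and $R'$ (no reordering), and, if $\sigma_s=(z,z+1)$, $\phi_{i-1}^{B_{s-1}}$ is the sublist of $C_{i-1}^{B_{s-1}}$ of those $(R,R')$ for which $z$ appears before $z+1$ in the concatenated tuple $(R,R')$. Finally $C_i^B:=C_i^{B_N}$. Sums over $C_i^B$ count multiplicity. *)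

(* Defs.v *)
From HB Require Import structures.
From mathcomp Require Import all_boot all_fingroup all_algebra.
From mathcomp Require Import generic_quotient ring_quotient.
From mathcomp Require Import boolp zify.
From mathcomp.multinomials Require Import monalg.

Set Implicit Arguments.
Unset Strict Implicit.
Unset Printing Implicit Defensive.

Import GRing.Theory.
Local Open Scope ring_scope.
Local Open Scope quotient_scope.

Local Notation "x %:F" := (@FracField.tofrac _ x).

(** * The ring k[q, q^-1] of Laurent polynomials *)

Section LaurentRing.
Variable k : fieldType.

(* k[q, q^-1] is realised inside its fraction field k(q), as the subring of   *)
(* the fractions p / q^m with p a polynomial in q.                            *)
Definition laurent_pred : {pred {fraction {poly k}}} :=
  fun x => `[< exists (p : {poly k}) (m : nat), x = p%:F / 'X%:F ^+ m >].

Lemma laurentP x :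
  reflect (exists (p : {poly k}) (m : nat), x = p%:F / 'X%:F ^+ m)
          (x \in laurent_pred).
Proof. exact: asboolP. Qed.

Lemma tofracX_neq0 : ('X : {poly k})%:F != 0.
Proof. by rewrite tofrac_eq0 polyX_eq0. Qed.

Fact laurent_subring : subring_closed laurent_pred.
Proof.
have X0 m : ('X : {poly k})%:F ^+ m != 0 by rewrite expf_neq0 // tofracX_neq0.
split.
- by apply/laurentP; exists 1, 0; rewrite expr0 divr1 rmorph1.
- move=> _ _ /laurentP [p [m ->]] /laurentP [p' [m' ->]]; apply/laurentP.
  exists (p * 'X^m' - p' * 'X^m), (m + m')%N.
  by rewrite -mulNr addf_div // exprD rmorphB !rmorphM !rmorphXn mulNr.
- move=> _ _ /laurentP [p [m ->]] /laurentP [p' [m' ->]]; apply/laurentP.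
  by exists (p * p'), (m + m')%N; rewrite mulf_div exprD rmorphM.
Qed.

HB.instance Definition _ :=
  GRing.isSubringClosed.Build {fraction {poly k}} laurent_pred laurent_subring.

Record laurent := Laurent {
  laurent_val :> {fraction {poly k}};
  _ : laurent_val \in laurent_pred
}.

HB.instance Definition _ := [isSub for laurent_val].
HB.instance Definition _ := [Choice of laurent by <:].
HB.instance Definition _ := [SubChoice_isSubComNzRing of laurent by <:].

Definition laurent_unit : {pred laurent} :=
  fun x => (val x != 0) && ((val x)^-1 \in laurent_pred).

Definition laurent_inv (x : laurent) : laurent :=
  if x \in laurent_unit then insubd x (val x)^-1 else x.

Fact laurent_mulVr : {in laurent_unit, left_inverse 1 laurent_inv *%R}.
Proof.
move=> x xU; rewrite /laurent_inv xU; move: xU => /andP [x0 xV].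
by apply: val_inj; rewrite rmorphM rmorph1 /= val_insubd xV mulVf.
Qed.

Fact laurent_unitP (x y : laurent) : y * x = 1 -> x \in laurent_unit.
Proof.
move=> /(congr1 val); rewrite rmorphM rmorph1 /= => yx1.
have x0 : val x != 0.
  apply/eqP=> x0; move: yx1; rewrite x0 mulr0 => /esym/eqP.
  by rewrite (negPf (oner_neq0 _)).
apply/andP; split=> //.
rewrite -[_^-1]mul1r -yx1 mulfK //; exact: (valP y).
Qed.

Fact laurent_inv_out : {in [predC laurent_unit], laurent_inv =1 id}.
Proof. by move=> x; rewrite inE /laurent_inv => /negPf ->. Qed.

HB.instance Definition _ := GRing.ComNzRing_hasMulInverse.Build laurent
  laurent_mulVr laurent_unitP laurent_inv_out.

Fact laurent_q_subproof : ('X : {poly k})%:F \in laurent_pred.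
Proof. by apply/laurentP; exists 'X, 0; rewrite expr0 divr1. Qed.

Definition qvar : laurent := Laurent laurent_q_subproof.

Lemma qvar_unit : qvar \is a GRing.unit.
Proof.
apply/andP; split; first exact: tofracX_neq0.
by apply/laurentP; exists 1, 1; rewrite rmorph1 expr1 mul1r.
Qed.

End LaurentRing.


(** * The quantum matrix algebra *)

Section FreeAlgebra.
Variables (R : comNzRingType) (X : choiceType).

(* The free (non-commutative) R-algebra on X is the monoid algebra of the     *)
(* words in X.                                                                *)
Definition free_alg : Type := {malg R[{fmonom X}]}.
HB.instance Definition _ := GRing.Lalgebra.on free_alg.

Fact free_alg_scaleAr (c : R) (x y : free_alg) : c *: (x * y) = x * (c *: y).
Proof.
move: (x : {malg R[{fmonom X}]}) (y : {malg R[{fmonom X}]}) => {}x {}y.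
have comm_c : x * c%:MP = c%:MP * x.
  rewrite !malgM_def fgmulgU fgmulUg; apply: eq_bigr => w _.
  by rewrite mulm1 mul1m mulrC.
have cy := mul_malgC c y; have cxy := mul_malgC c (x * y).
apply: (etrans (esym cxy)); apply: (etrans (mulrA c%:MP x y)).
apply: (etrans (congr1 ( *%R^~ y) (esym comm_c))).
apply: (etrans (esym (mulrA x c%:MP y))).
exact: (congr1 ( *%R x) cy).
Qed.

HB.instance Definition _ :=
  @GRing.LSemiAlgebra_isSemiAlgebra.Build R free_alg free_alg_scaleAr.

Definition free_gen (x : X) : free_alg := << fmu x >>.

End FreeAlgebra.

Section QuantumMatrixRelations.
Variables (k : fieldType) (n : nat).
Local Notation kq := (laurent k).
Local Notation A := (free_alg kq ('I_n * 'I_n)%type).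

Definition letter (i j : 'I_n) : A := free_gen kq (i, j).

(* Each defining relation u = v is recorded as the element u - v.             *)
Inductive qmat_rel : A -> Prop :=
| QRow (i j l : 'I_n) : (j < l)%N ->
    qmat_rel (letter i j * letter i l
              - (qvar k)^-1 *: (letter i l * letter i j))
| QCol (i j l : 'I_n) : (j < l)%N ->
    qmat_rel (letter j i * letter l i
              - (qvar k)^-1 *: (letter l i * letter j i))
| QComm (i j i' j' : 'I_n) : (i < i')%N && (j' < j)%N || (i' < i)%N && (j < j')%N ->
    qmat_rel (letter i j * letter i' j' - letter i' j' * letter i j)
| QCross (i j i' j' : 'I_n) : (i < i')%N -> (j < j')%N ->
    qmat_rel (letter i j * letter i' j' - letter i' j' * letter i j
              - ((qvar k)^-1 - qvar k) *: (letter i' j * letter i j')).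

(* The two-sided ideal generated by the relations.                            *)
Inductive qmat_ideal_of : A -> Prop :=
| QIdeal0 : qmat_ideal_of 0
| QIdealD x y : qmat_ideal_of x -> qmat_ideal_of y -> qmat_ideal_of (x + y)
| QIdealM x r y : qmat_rel r -> qmat_ideal_of (x * r * y).

Definition qmat_ideal : {pred A} := fun x => `[< qmat_ideal_of x >].

Lemma qmat_idealP x : reflect (qmat_ideal_of x) (x \in qmat_ideal).
Proof. exact: asboolP. Qed.

Lemma qmat_idealMl a x : x \in qmat_ideal -> a * x \in qmat_ideal.
Proof.
move=> /qmat_idealP Ix; apply/qmat_idealP.
elim: Ix => [|u v _ Iu _ Iv|u r v rel_r].
- by rewrite mulr0; exact: QIdeal0.
- by rewrite mulrDr; exact: QIdealD.
- by rewrite !mulrA; exact: QIdealM.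
Qed.

Lemma qmat_idealMr a x : x \in qmat_ideal -> x * a \in qmat_ideal.
Proof.
move=> /qmat_idealP Ix; apply/qmat_idealP.
elim: Ix => [|u v _ Iu _ Iv|u r v rel_r].
- by rewrite mul0r; exact: QIdeal0.
- by rewrite mulrDl; exact: QIdealD.
- by rewrite -!mulrA mulrA; exact: QIdealM.
Qed.

Fact qmat_ideal_zmod : zmod_closed qmat_ideal.
Proof.
split; first by apply/qmat_idealP; exact: QIdeal0.
move=> x y Ix Iy; rewrite -[- y]mulN1r; apply/qmat_idealP.
by apply: QIdealD; apply/qmat_idealP; rewrite ?qmat_idealMl.
Qed.

HB.instance Definition _ :=
  GRing.isZmodClosed.Build A qmat_ideal qmat_ideal_zmod.

Lemma qmat_ideal1 : 1 \notin qmat_ideal.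
Proof.
have [e [eL eM eB eZ e1]] : exists e : A -> kq,
    [/\ forall i j, e (letter i j) = 0, {morph e : x y / x * y},
        {morph e : x y / x - y}, forall c x, e (c *: x) = c * e x & e 1 = 1].
  exists (@mcoeff {fmonom ('I_n * 'I_n)%type} kq mone); split.
  - by move=> i j; rewrite /letter /free_gen mcoeffU1 fmP fmuE [mone]fmoneE.
  - exact: rmorphM.
  - exact: raddfB.
  - by move=> c x; exact: (mcoeffZ c x mone).
  - exact: rmorph1.
have e2 i j i' j' : e (letter i j * letter i' j') = 0 by rewrite eM eL mul0r.
have e2B x y : e x = 0 -> e y = 0 -> e (x - y) = 0.
  by move=> ex ey; rewrite eB ex ey subr0.
have e2Z c x : e x = 0 -> e (c *: x) = 0 by move=> ex; rewrite eZ ex mulr0.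
have e_rel r : qmat_rel r -> e r = 0.
  case=> [i j l _|i j l _|i j i' j' _|i j i' j' _ _].
  - by apply: (e2B); [exact: e2|apply: (e2Z); exact: e2].
  - by apply: (e2B); [exact: e2|apply: (e2Z); exact: e2].
  - by apply: (e2B); exact: e2.
  - by apply: (e2B); [apply: (e2B); exact: e2|apply: (e2Z); exact: e2].
apply/qmat_idealP => I1.
suff /eqP : e 1 = 0 by rewrite e1 oner_eq0.
have e0 : e 0 = 0 by rewrite -[0]subr0 eB subrr.
elim: I1 => [//|x y _ ex _ ey|x r y rel_r].
  by rewrite -[y]opprK eB -[- y]sub0r eB e0 ex ey !subr0.
by rewrite !eM (e_rel r) // mulr0 mul0r.
Qed.

End QuantumMatrixRelations.

(* O_q(M_n(k)): the free algebra modulo the ideal of the relations.           *)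
Section QuantumMatrixAlgebra.
Variables (k : fieldType) (n : nat).
Local Notation kq := (laurent k).
Local Notation I := (@qmat_ideal k n).

Definition qmat : Type := Quotient.quot I.
HB.instance Definition _ := GRing.Zmodule.on qmat.
HB.instance Definition _ : EqQuotient _ (Quotient.equiv I) qmat :=
  EqQuotient.on qmat.

Definition qmat_pi (x : free_alg kq ('I_n * 'I_n)%type) : qmat := \pi_qmat x.

Lemma qmat_piP x y : reflect (qmat_pi x = qmat_pi y) (x - y \in I).
Proof. by rewrite Quotient.idealrBE; exact: eqP. Qed.

Lemma qmat_repr x : qmat_pi (repr x) = x.
Proof. exact: reprK. Qed.

Lemma qmat_piD x y : qmat_pi (x + y) = qmat_pi x + qmat_pi y.
Proof. exact: Quotient.pi_add. Qed.

Definition qmat_mul (x y : qmat) : qmat := qmat_pi (repr x * repr y).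
Definition qmat_scale (c : kq) (x : qmat) : qmat := qmat_pi (c *: repr x).

Lemma qmat_piM x y : qmat_pi (x * y) = qmat_mul (qmat_pi x) (qmat_pi y).
Proof.
have [Ix Iy] : x - repr (qmat_pi x) \in I /\ y - repr (qmat_pi y) \in I.
  by split; apply/qmat_piP; rewrite qmat_repr.
apply/qmat_piP; set x' := repr (qmat_pi x); set y' := repr (qmat_pi y).
have -> : x * y - x' * y' = x * (y - y') + (x - x') * y'.
  by rewrite mulrBr mulrBl addrA subrK.
by apply: rpredD; [exact: qmat_idealMl|exact: qmat_idealMr].
Qed.

Lemma qmat_piZ c x : qmat_pi (c *: x) = qmat_scale c (qmat_pi x).
Proof.
have Ix : x - repr (qmat_pi x) \in I by apply/qmat_piP; rewrite qmat_repr.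
by apply/qmat_piP; rewrite -scalerBr -[_ - _]mul1r scalerAl qmat_idealMl.
Qed.

Fact qmat_mulA : associative qmat_mul.
Proof.
move=> x y z; rewrite -[x]qmat_repr -[y]qmat_repr -[z]qmat_repr.
by rewrite -!qmat_piM mulrA.
Qed.

Fact qmat_mul1x : left_id (qmat_pi 1) qmat_mul.
Proof. by move=> x; rewrite -[x]qmat_repr -qmat_piM mul1r. Qed.

Fact qmat_mulx1 : right_id (qmat_pi 1) qmat_mul.
Proof. by move=> x; rewrite -[x]qmat_repr -qmat_piM mulr1. Qed.

Fact qmat_mulDl : left_distributive qmat_mul +%R.
Proof.
move=> x y z; rewrite -[x]qmat_repr -[y]qmat_repr -[z]qmat_repr.
by rewrite -qmat_piD -!qmat_piM -qmat_piD mulrDl.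
Qed.

Fact qmat_mulDr : right_distributive qmat_mul +%R.
Proof.
move=> x y z; rewrite -[x]qmat_repr -[y]qmat_repr -[z]qmat_repr.
by rewrite -qmat_piD -!qmat_piM -qmat_piD mulrDr.
Qed.

Lemma qmat_pi0 : qmat_pi 0 = 0.
Proof. by apply: (addrI (qmat_pi 0)); rewrite -qmat_piD !addr0. Qed.

Fact qmat_1_neq0 : qmat_pi 1 != 0.
Proof.
apply: contra (qmat_ideal1 k n) => /eqP pi1.
by rewrite -[1]subr0; apply/qmat_piP; rewrite pi1 qmat_pi0.
Qed.

HB.instance Definition _ := GRing.Zmodule_isNzRing.Build qmat
  qmat_mulA qmat_mul1x qmat_mulx1 qmat_mulDl qmat_mulDr qmat_1_neq0.

Lemma qmat_pi_mul x y : qmat_pi (x * y) = qmat_pi x * qmat_pi y.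
Proof. exact: qmat_piM. Qed.

Fact qmat_scaleA a b x : qmat_scale a (qmat_scale b x) = qmat_scale (a * b) x.
Proof. by rewrite -[x]qmat_repr -!qmat_piZ scalerA. Qed.

Fact qmat_scale1 : left_id 1 qmat_scale.
Proof. by move=> x; rewrite -[x]qmat_repr -qmat_piZ scale1r. Qed.

Fact qmat_scaleDr : right_distributive qmat_scale +%R.
Proof.
move=> c x y; rewrite -[x]qmat_repr -[y]qmat_repr.
by rewrite -qmat_piD -!qmat_piZ -qmat_piD scalerDr.
Qed.

Fact qmat_scaleDl x : {morph qmat_scale^~ x : a b / a + b}.
Proof.
by move=> a b; rewrite -[x]qmat_repr -!qmat_piZ -qmat_piD scalerDl.
Qed.

HB.instance Definition _ := GRing.Zmodule_isLmodule.Build kq qmat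
  qmat_scaleA qmat_scale1 qmat_scaleDr qmat_scaleDl.

Lemma qmat_pi_scale c x : qmat_pi (c *: x) = c *: qmat_pi x.
Proof. exact: qmat_piZ. Qed.

Fact qmat_scaleAl (c : kq) (x y : qmat) : c *: (x * y) = (c *: x) * y.
Proof.
rewrite -[x]qmat_repr -[y]qmat_repr -qmat_pi_mul -!qmat_pi_scale -qmat_pi_mul.
by rewrite scalerAl.
Qed.

HB.instance Definition _ := GRing.Lmodule_isLalgebra.Build kq qmat qmat_scaleAl.

Fact qmat_scaleAr (c : kq) (x y : qmat) : c *: (x * y) = x * (c *: y).
Proof.
rewrite -[x]qmat_repr -[y]qmat_repr -qmat_pi_mul -!qmat_pi_scale -qmat_pi_mul.
by rewrite scalerAr.
Qed.

HB.instance Definition _ := GRing.Lalgebra_isAlgebra.Build kq qmat qmat_scaleAr.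

Lemma qmat_pi_rel r : qmat_rel r -> qmat_pi r = 0.
Proof.
move=> rel_r; rewrite -qmat_pi0; apply/qmat_piP; rewrite subr0.
by apply/qmat_idealP; rewrite -[r]mulr1 -[r]mul1r; exact: QIdealM.
Qed.

Definition xgen (i j : 'I_n) : qmat := qmat_pi (letter k i j).

End QuantumMatrixAlgebra.

(** * Standard column towers and the lists C_i^B *)

Section StandardTower.
Variable T : eqType.
(* V is the increasing enumeration v_1 < ... < v_m of the ordered set; the    *)
(* tuples B, R, R' are sequences of elements of V.                            *)
Variable V : seq T.

(* The identification v_a <-> a of V with {1, ..., m}.                        *)
Definition rank (v : T) : nat := (index v V).+1.

(* v_z <-> v_(z+1), for 1 <= z < m.  The default values of nth are not        *)
(* reached, the elements of V being numbered from 0 in nth.                   *)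
Definition adj_transp (z : nat) (v : T) : T :=
  if rank v == z then nth v V z
  else if rank v == z.+1 then nth v V z.-1
  else v.

(* b_(a+1), as an element of {1, ..., m}, for a counted from 0; the default   *)
(* value of nth yields the convention b_(p+1) = m + 1.                        *)
Definition col_entry (B : seq T) (a : nat) : nat :=
  nth (size V).+1 (map rank B) a.

(* The largest position (counted from 0) followed by a gap; there is one as   *)
(* soon as B is not (m-p+1, ..., m).                                          *)
Definition std_pos (B : seq T) : nat :=
  \max_(a < size B | (1 < col_entry B a.+1 - col_entry B a)%N) a.

(* The z such that the standard column transposition of B is (z, z+1).        *)
Definition std_z (B : seq T) : nat := col_entry B (std_pos B).

Definition std_step (B : seq T) : seq T := map (adj_transp (std_z B)) B.

Definition top_col (p : nat) : seq T := drop (size V - p) V.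

(* Length of the standard column tower of B: the number of steps needed to    *)
(* reach B_0.  The search bound is justified by intcP below.                  *)
Definition intc (B : seq T) : nat :=
  find (fun t => iter t std_step B == top_col (size B))
       (iota 0 (size V * size B).+1).

Definition occurs_before (z : nat) (P : seq T * seq T) : bool :=
  let W := map rank (P.1 ++ P.2) in (index z W < index z.+1 W)%N.

(* C_i^B for B at level s of a standard column tower.                         *)
Fixpoint col_list_at (s : nat) (B : seq T) (i : nat) : seq (seq T * seq T) :=
  if s is s'.+1 then
    let z := std_z B in
    let B' := std_step B in
    (if i is i'.+1
     then [seq P <- col_list_at s' B' i' | ~~ occurs_before z P] else [::])
    ++ [seq (map (adj_transp z) P.1, map (adj_transp z) P.2)
       | P <- col_list_at s' B' i]
  else if i == 0%N then [:: (B, [seq v <- V | v \notin B])] else [::].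

Definition col_list (B : seq T) (i : nat) : seq (seq T * seq T) :=
  col_list_at (intc B) B i.

Lemma col_list_at_gt s B i : (s < i)%N -> col_list_at s B i = [::].
Proof.
elim: s B i => [|s IHs] B [|i] //= lt_si.
by rewrite !IHs // ltnW.
Qed.

End StandardTower.

Section TowerLength.
Variables (T : eqType) (V : seq T).
Hypothesis V_uniq : uniq V.
Local Notation m := (size V).
Local Notation rank := (rank V).
Local Notation col_entry := (col_entry V).

Let col (B : seq T) := {subset B <= V} /\ sorted ltn (map rank B).

Let rank_gt0 v : (0 < rank v)%N. Proof. by []. Qed.

Let rank_le v : v \in V -> (rank v <= m)%N.
Proof. by rewrite -index_mem. Qed.

Let rank_inj : {in V &, injective rank}.
Proof.
move=> u v uV vV [] /(congr1 (nth u V)).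
by rewrite !nth_index.
Qed.

Let rank_nth x0 i : (i < m)%N -> rank (nth x0 V i) = i.+1.
Proof. by move=> lt_im; rewrite /Defs.rank index_uniq. Qed.

Let rank_transp z v : v \in V -> (0 < z < m)%N ->
  adj_transp V z v \in V /\ rank (adj_transp V z v) =
    if rank v == z then z.+1 else if rank v == z.+1 then z else rank v.
Proof.
move=> vV /andP [z0 zm]; rewrite /adj_transp.
have z1m : (z.-1 < m)%N by lia.
case: ifP => _; first by rewrite mem_nth // rank_nth.
by case: ifP => _ //; rewrite mem_nth // rank_nth // prednK.
Qed.

Let map_rank_inj B B' : {subset B <= V} -> {subset B' <= V} ->
  map rank B = map rank B' -> B = B'.
Proof.
elim: B B' => [|x B IHB] [|y B'] // sB sB' [exy eB].
have xy : x = y.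
  apply: rank_inj; [exact/sB/mem_head|exact/sB'/mem_head|].
  by rewrite /Defs.rank exy.
rewrite xy (IHB B') // => u uB; [apply: sB | apply: sB'];
  by rewrite inE uB orbT.
Qed.

Let entry_le B a : {subset B <= V} -> (a < size B)%N -> (col_entry B a <= m)%N.
Proof.
case: B => // x B sB lt_aB; rewrite /Defs.col_entry (nth_map x) //.
by rewrite rank_le // sB // mem_nth.
Qed.

Let entry_mono B a b : sorted ltn (map rank B) -> (a < b < size B)%N ->
  (col_entry B a < col_entry B b)%N.
Proof.
move=> srt /andP [lt_ab lt_b]; rewrite /Defs.col_entry.
by apply: (sorted_ltn_nth ltn_trans) => //; rewrite inE size_map //; lia.
Qed.

Let entry_out B : col_entry B (size B) = m.+1.
Proof. by rewrite /Defs.col_entry nth_default // size_map. Qed.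

Let size_col B : col B -> (size B <= m)%N.
Proof.
move=> [sB srt]; apply: uniq_leq_size => //.
by apply: map_uniq; exact: sorted_uniq ltn_trans ltnn _ srt.
Qed.

Let rank_top p : (p <= m)%N -> map rank (top_col V p) = iota (m - p).+1 p.
Proof.
move=> le_pm; rewrite /top_col map_drop.
have -> : map rank V = iota 1 m.
  case: V V_uniq rank_nth => [//|x V'] _ rk.
  apply: (@eq_from_nth _ 0%N); first by rewrite size_map size_iota.
  by move=> i; rewrite size_map => lt_i; rewrite nth_iota // (nth_map x) // rk.
by rewrite drop_iota; congr iota; lia.
Qed.

Let no_gap_top B : col B ->
  (forall a, (a < size B)%N -> (col_entry B a.+1 - col_entry B a <= 1)%N) ->
  B = top_col V (size B).
Proof.
move=> cB gap; have le_pm := size_col cB; have [sB srt] := cB.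
apply: map_rank_inj => //; first by move=> u /mem_drop.
rewrite rank_top //.
have entry i : (i <= size B)%N -> col_entry B (size B - i) = (m.+1 - i)%N.
  elim: i => [|i IHi] lt_i; first by rewrite subn0 entry_out subn0.
  have lt_p : (size B - i.+1 < size B)%N by lia.
  have := gap _ lt_p; have -> : (size B - i.+1).+1 = (size B - i)%N by lia.
  rewrite (IHi (ltnW lt_i)); have le_e := entry_le sB lt_p.
  have : (col_entry B (size B - i.+1) < col_entry B (size B - i))%N.
    case: i IHi lt_i lt_p le_e => [|i] IHi lt_i lt_p le_e.
      by rewrite subn0 entry_out; lia.
    by apply: entry_mono => //; lia.
  by rewrite (IHi (ltnW lt_i)); lia.
apply: (@eq_from_nth _ 0%N); first by rewrite size_map size_iota.
move=> i; rewrite size_map => lt_i; rewrite nth_iota //.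
have := entry _ (leq_subr i (size B)); rewrite subKn 1?ltnW // /Defs.col_entry.
by rewrite (set_nth_default 0%N) ?size_map // => ->; lia.
Qed.

Let std_pos_gap B : col B -> B != top_col V (size B) ->
  (std_pos V B < size B)%N /\
  (1 < col_entry B (std_pos V B).+1 - col_entry B (std_pos V B))%N.
Proof.
move=> cB neB; rewrite /std_pos.
set P := fun a : 'I_(size B) => (1 < col_entry B a.+1 - col_entry B a)%N.
have [a Pa] : exists a, P a.
  apply/existsP; apply: contra_neqT neB; rewrite negb_exists => /forallP nP.
  by apply: no_gap_top => // a lt_a; have := nP (Ordinal lt_a); rewrite -leqNgt.
have card_P : (0 < #|P|)%N by apply/card_gt0P; exists a.
by have [b Pb ->] := eq_bigmax_cond (fun a : 'I__ => a : nat) card_P; split.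
Qed.

Let std_stepE B : col B -> B != top_col V (size B) ->
  {subset std_step V B <= V} /\ forall j, (j < size B)%N ->
    col_entry (std_step V B) j =
    if j == std_pos V B then (col_entry B j).+1 else col_entry B j.
Proof.
move=> cB neB; have [lt_a gap_a] := std_pos_gap cB neB; have [sB srt] := cB.
set a := std_pos V B in lt_a gap_a *.
have e1 : (col_entry B a.+1 <= m.+1)%N.
  case: (ltnP a.+1 (size B)) => [lt_a1|le_a1].
    by apply: leq_trans (entry_le sB lt_a1) _.
  by have -> : a.+1 = size B by [lia]; rewrite entry_out.
have z_lim : (0 < col_entry B a < m)%N.
  rewrite {1}/Defs.col_entry; case: (B) lt_a gap_a e1 => // x0 B0 lt_a gap_a e1.
  by rewrite (nth_map x0) // rank_gt0 /=; lia.
split=> [_ /mapP [v vB ->]|j lt_j].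
  by have [] := rank_transp (sB _ vB) z_lim.
have entry_nth x0 i B1 : (i < size B1)%N -> col_entry B1 i = rank (nth x0 B1 i).
  by move=> lt_i; rewrite /Defs.col_entry (nth_map x0).
have x0 : T by case: (B) lt_j.
have lt_a0 := lt_a; have lt_ja : (j < size (std_step V B))%N by rewrite size_map.
rewrite !(entry_nth x0) // (nth_map x0) //.
have vV : nth x0 B j \in V by rewrite sB // mem_nth.
have [_ ->] := rank_transp vV z_lim; rewrite -!(entry_nth x0) //.
have [->|ne_ja] := eqVneq j a; first by rewrite eqxx.
have cmp : (col_entry B j < col_entry B a)%N \/
           ((col_entry B a).+1 < col_entry B j)%N.
  case: (ltngtP j a) ne_ja => // [lt_j_a|lt_a_j] _.
    by left; apply: entry_mono => //; rewrite lt_j_a.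
  right; case: (ltngtP a.+1 j) => [lt|lt|eq_j].
  - have : (col_entry B a.+1 < col_entry B j)%N.
      by apply: entry_mono => //; rewrite lt.
    lia.
  - lia.
  - rewrite -eq_j; lia.
by case: eqP => [|_]; [lia|case: eqP => //; lia].
Qed.

Let std_step_col B : col B -> B != top_col V (size B) ->
  col (std_step V B) /\
  sumn (map rank (std_step V B)) = (sumn (map rank B)).+1.
Proof.
move=> cB neB; have [sB' entryE] := std_stepE cB neB.
have [lt_a gap_a] := std_pos_gap cB neB; have [sB srt] := cB.
have sz : size (std_step V B) = size B by rewrite size_map.
have nth0 B1 j : (j < size B1)%N -> nth 0%N (map rank B1) j = col_entry B1 j.
  by move=> lt_j; apply: set_nth_default; rewrite size_map.
split.
  split=> //; apply/(sortedP 0%N) => j; rewrite size_map sz => lt_j.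
  rewrite !nth0 ?sz ?(ltnW lt_j) // !entryE ?(ltnW lt_j) //.
  have lt_e : (col_entry B j < col_entry B j.+1)%N.
    by apply: entry_mono => //; rewrite ltnSn.
  case: (eqVneq j (std_pos V B)) => [eq_j|_]; last by case: ifP => _; lia.
  by rewrite -eq_j in gap_a *; case: ifP => _; lia.
have sumE B1 : sumn (map rank B1) = (\sum_(j < size B1) col_entry B1 j)%N.
  rewrite sumnE (big_nth 0%N) big_mkord size_map.
  by apply: eq_bigr => j _; rewrite nth0.
rewrite !sumE sz (bigD1 (Ordinal lt_a)) // [in RHS](bigD1 (Ordinal lt_a)) //=.
rewrite entryE // eqxx addSn; congr (_ + _).+1.
apply: eq_bigr => j; rewrite -val_eqE /= => ne_j.
by rewrite entryE // (negPf ne_j).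
Qed.

Let sum_le B : col B -> (sumn (map rank B) <= m * size B)%N.
Proof.
move=> [sB _]; elim: B sB => [|x B IHB] sB; first by rewrite muln0.
rewrite /= mulnS leq_add ?rank_le ?sB ?mem_head // IHB // => u uB.
by apply: sB; rewrite inE uB orbT.
Qed.

Lemma intcP B : {subset B <= V} -> sorted ltn (map rank B) ->
  iter (intc V B) (std_step V) B = top_col V (size B) /\
  forall t, (t < intc V B)%N -> iter t (std_step V) B != top_col V (size B).
Proof.
move=> sB srt; have cB : col B by split.
set P := fun t => iter t (std_step V) B == top_col V (size B).
have size_iter t : size (iter t (std_step V) B) = size B.
  by elim: t => //= t IHt; rewrite size_map.
have hasP : has P (iota 0 (m * size B).+1).
  apply/negPn/negP => /hasPn nP.
  have iterP t : (t <= (m * size B).+1)%N -> col (iter t (std_step V) B) /\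
      sumn (map rank (iter t (std_step V) B)) = (sumn (map rank B) + t)%N.
    elim: t => [|t IHt] lt_t /=; first by rewrite addn0.
    have [cBt sumBt] := IHt (ltnW lt_t).
    have neBt : iter t (std_step V) B != top_col V (size B).
      by apply: nP; rewrite mem_iota.
    rewrite -(size_iter t) in neBt.
    by have [cB' ->] := std_step_col cBt neBt; rewrite sumBt addnS.
  have [cBt sumBt] := iterP _ (leqnn _).
  by have := sum_le cBt; rewrite sumBt size_iter; lia.
have lt_intc : (intc V B < (m * size B).+1)%N.
  by move: hasP; rewrite has_find size_iota.
split; first by apply/eqP; have := nth_find 0%N hasP; rewrite nth_iota.
move=> t lt_t; have := before_find 0%N lt_t; rewrite nth_iota ?add0n => [->//|].
exact: ltn_trans lt_t lt_intc.
Qed.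

End TowerLength.
(** * Quantum minors *)

Fixpoint inversions (u : seq nat) : nat :=
  if u is x :: u' then (count (ltn^~ x) u' + inversions u')%N else 0%N.

Section QuantumMinor.
Variables (k : fieldType) (n : nat).

Definition inv_tuple (u : seq 'I_n) : nat := inversions (map val u).

Definition inv_perm (p : nat) (sigma : 'S_p) : nat :=
  inversions [seq val (sigma i) | i <- enum 'I_p].

(* [A, B]; only meaningful when A and B have the same size, in which case the *)
(* default value of nth is not reached.                                       *)
Definition qminor (A B : seq 'I_n) : qmat k n :=
  \sum_(sigma : 'S_(size A))
    (- qvar k) ^- inv_perm sigma *:
      \prod_(i < size A)
        (let a := tnth (in_tuple A) i in xgen k a (nth a B (sigma i))).

(* (R u C)_ord *)
Definition ord_union (R C : seq 'I_n) : seq 'I_n :=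
  [seq v <- enum 'I_n | (v \in R) || (v \in C)].

Definition increasing (u : seq 'I_n) : bool := sorted ltn (map val u).

End QuantumMinor.

(* Main.v *)
From HB Require Import structures.
Require Import Defs.
From mathcomp Require Import all_boot all_fingroup all_algebra.
From mathcomp Require Import generic_quotient.
From mathcomp Require Import zify ring.
From mathcomp.multinomials Require Import monalg.

(* For adjacent columns a and b, the quantized enveloping algebra of gl_n acts
   on O_q(M_n) through a twisted derivation D, D(yz) = D(y) z + K(y) D(z), which
   replaces column a by column b.  On a quantum minor, D replaces column a by b,
   and is 0 when a is not a column or when b is one already.
   - If column a occurs once more than column b in a product of two minors, D
     exchanges a and b in both factors without any scalar.
   - If a and b occur once each, q^-1 D_(b->a) D_(a->b) - q^-1 is a generator of
     the Hecke algebra acting on the columns.  Conjugating by the previous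
     exchanges gives such a generator T for any v < w consecutive in
     V = (I u J) \ C, whatever columns of C lie between them.  The rule
     that builds the lists C_i^B is precisely the action of T on the terms
     [1..r, R u C] [r+1..n, R' u C], so the expansion climbs the tower.
   - At the top of the tower the two minors q-commute.  As #V + 2 #C = n, there
     are as many columns in neither minor as in both: trading a pair of such
     columns for two columns that occur once, D reduces the claim to the case
     where I and J are complementary and J < I, where all generators commute. *)

Set Implicit Arguments.
Unset Strict Implicit.
Unset Printing Implicit Defensive.

Import GRing.Theory.
Local Open Scope ring_scope.

(** * Transvections of the quantum matrix algebra *)

Section Relations.
Variables (k : fieldType) (n : nat).
Local Notation q := (qvar k).
Local Notation x := (@xgen k n).

Let relE (r : free_alg (laurent k) ('I_n * 'I_n)%type) :
  qmat_rel r -> qmat_pi r = 0 := @qmat_pi_rel k n r.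

Lemma qmat_piB (u v : free_alg (laurent k) ('I_n * 'I_n)%type) :
  qmat_pi (u - v) = qmat_pi u - qmat_pi v.
Proof. by rewrite qmat_piD -scaleN1r qmat_pi_scale scaleN1r. Qed.

Lemma xgen_row (i j l : 'I_n) : (j < l)%N -> x i j * x i l = q^-1 *: (x i l * x i j).
Proof.
move=> lt_jl; apply/eqP; rewrite -subr_eq0.
by rewrite /xgen -!qmat_pi_mul -qmat_pi_scale -qmat_piB relE //; exact: QRow.
Qed.

Lemma xgen_col (i j l : 'I_n) : (j < l)%N -> x j i * x l i = q^-1 *: (x l i * x j i).
Proof.
move=> lt_jl; apply/eqP; rewrite -subr_eq0.
by rewrite /xgen -!qmat_pi_mul -qmat_pi_scale -qmat_piB relE //; exact: QCol.
Qed.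

Lemma xgen_comm (i j i' j' : 'I_n) :
  (i < i')%N -> (j' < j)%N -> x i j * x i' j' = x i' j' * x i j.
Proof.
move=> lt_i lt_j; apply/eqP; rewrite -subr_eq0.
by rewrite /xgen -!qmat_pi_mul -qmat_piB relE //; apply: QComm; rewrite lt_i lt_j.
Qed.

Lemma xgen_cross (i j i' j' : 'I_n) : (i < i')%N -> (j < j')%N ->
  x i j * x i' j' = x i' j' * x i j + (q^-1 - q) *: (x i' j * x i j').
Proof.
move=> lt_i lt_j; apply/eqP; rewrite -subr_eq0 opprD addrA.
rewrite /xgen -!qmat_pi_mul -qmat_pi_scale -!qmat_piB relE //; exact: QCross.
Qed.

End Relations.

(** * Universal property of the quantum matrix algebra *)

Section QmatLift.
Variables (k : fieldType) (n : nat) (S : nzRingType).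
Local Notation kq := (laurent k).
Local Notation A := (free_alg kq ('I_n * 'I_n)%type).
Variables (iota : {rmorphism kq -> S}) (f : 'I_n * 'I_n -> S).
Hypothesis iota_central : forall c y, GRing.comm (iota c) y.
Local Notation q := (qvar k).

Let word (m : {fmonom ('I_n * 'I_n)%type}) : S := \prod_(u <- (m : seq _)) f u.

Let word_mmorphism : mmorphism word.
Proof.
split=> [u v|]; first by rewrite /word fmM big_cat.
by rewrite /word fm1 big_nil.
Qed.

HB.instance Definition _ := isMultiplicative.Build _ _ word word_mmorphism.

(** The evaluation is the map of monoid algebras induced by [word]; it is multiplicative because the
    scalars [iota c] are central. *)
Lemma free_alg_lift : exists ev : A -> S,
  [/\ {morph ev : y z / y * z}, ev 1 = 1, {morph ev : y z / y - z},
      forall c y, ev (c *: y) = iota c * ev y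
    & forall i j, ev (letter k i j) = f (i, j)].
Proof.
exists (mmap iota word); split.
- by move=> y z; rewrite (commr_mmap_is_multiplicative _).1.
- by rewrite (commr_mmap_is_multiplicative _).2.
- by move=> y z; rewrite mmapB.
- by move=> c y; rewrite mmapZ.
move=> i j; rewrite mmapU -[RHS]mul1r; congr (_ * _).
  exact: (rmorph1 iota).
by rewrite /word /= fmU big_seq1.
Qed.

Hypothesis f_row : forall i j l : 'I_n, (j < l)%N ->
  f (i, j) * f (i, l) = iota q^-1 * (f (i, l) * f (i, j)).
Hypothesis f_col : forall i j l : 'I_n, (j < l)%N ->
  f (j, i) * f (l, i) = iota q^-1 * (f (l, i) * f (j, i)).
Hypothesis f_comm : forall i j i' j' : 'I_n, (i < i')%N -> (j' < j)%N ->
  f (i, j) * f (i', j') = f (i', j') * f (i, j).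
Hypothesis f_cross : forall i j i' j' : 'I_n, (i < i')%N -> (j < j')%N ->
  f (i, j) * f (i', j') =
  f (i', j') * f (i, j) + iota (q^-1 - q) * (f (i', j) * f (i, j')).

(** Evaluation of words kills each defining relation, hence the two-sided ideal, and so descends to
    the quotient. *)
Lemma qmat_lift : exists Phi : {rmorphism qmat k n -> S},
  (forall i j, Phi (xgen k i j) = f (i, j)) /\
  (forall c y, Phi (c *: y) = iota c * Phi y).
Proof.
have [ev [evM ev1 evB evZ evL]] := free_alg_lift.
have evLL i j i' j' : ev (letter k i j * letter k i' j') = f (i, j) * f (i', j').
  by rewrite evM !evL.
have ev_rel r : qmat_rel r -> ev r = 0.
  case=> [i j l lt_jl|i j l lt_jl|i j i' j' lt|i j i' j' lt_i lt_j].
  - rewrite evB evZ; apply/eqP; rewrite subr_eq0; apply/eqP.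
    apply: etrans (evLL _ _ _ _) _; rewrite f_row //.
    by congr (_ * _); exact: esym (evLL _ _ _ _).
  - rewrite evB evZ; apply/eqP; rewrite subr_eq0; apply/eqP.
    apply: etrans (evLL _ _ _ _) _; rewrite f_col //.
    by congr (_ * _); exact: esym (evLL _ _ _ _).
  - rewrite evB; apply/eqP; rewrite subr_eq0; apply/eqP.
    apply: etrans (evLL _ _ _ _) _; apply: etrans _ (esym (evLL _ _ _ _)).
    by case/orP: lt => /andP [lt1 lt2]; [|symmetry]; exact: f_comm.
  - rewrite evB evB evZ; apply/eqP; rewrite -addrA -opprD subr_eq0; apply/eqP.
    apply: etrans (evLL _ _ _ _) _; rewrite f_cross //.
    congr (_ + _); first exact: esym (evLL _ _ _ _).
    by congr (_ * _); exact: esym (evLL _ _ _ _).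
have ev0 : ev 0 = 0 by rewrite -[0]subr0 evB subrr.
have ev_ideal y : y \in @qmat_ideal k n -> ev y = 0.
  move/qmat_idealP; elim=> [//|u v _ eu _ ev_|u r v rel_r].
    by rewrite -[v]opprK evB -[- v]sub0r evB ev0 eu ev_ !subr0.
  by rewrite evM evM (ev_rel _ rel_r) mulr0 mul0r.
(* By [phi_pi] any representative may be used; additivity and multiplicativity are then inherited
   from [ev]. *)
pose phi (y : qmat k n) : S := ev (repr y).
have phi_pi y : phi (qmat_pi y) = ev y.
  apply/eqP; rewrite -subr_eq0 /phi -evB; apply/eqP/ev_ideal.
  by apply/qmat_piP; rewrite qmat_repr.
have phiB : zmod_morphism phi.
  by move=> y z; rewrite -{1}[y]qmat_repr -{1}[z]qmat_repr -qmat_piB phi_pi evB.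
have phiM : monoid_morphism phi.
  split=> [|y z]; first by rewrite -[1]/(qmat_pi 1) phi_pi.
  by rewrite -{1}[y]qmat_repr -{1}[z]qmat_repr -qmat_pi_mul phi_pi evM.
pose ad := GRing.isZmodMorphism.Build _ _ phi phiB.
pose mu := GRing.isMonoidMorphism.Build _ _ phi phiM.
pose Phi : {rmorphism qmat k n -> S} := HB.pack phi ad mu.
exists Phi; split=> [i j|c y]; first by rewrite /= phi_pi.
by rewrite -{1}[y]qmat_repr -qmat_pi_scale /= phi_pi evZ.
Qed.

End QmatLift.

Lemma mulmx_scalarE (R : nzRingType) n (y : 'M[R]_n) a i j :
  (y *m a%:M) i j = y i j * a.
Proof.
rewrite mxE (bigD1 j) //= big1 => [|l ne_lj]; last first.
  by rewrite mxE (negPf ne_lj) mulr0.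
by rewrite mxE eqxx addr0.
Qed.

(** * Twisted derivations as morphisms to triangular matrices *)

Section UpperTriangular.
Variables (K : comNzRingType) (R : algType K).

(** The corner of a product, [p * d' + d * l'], is the twisted Leibniz rule: a ring morphism y ->
    [ut_mx (K y) (D y) y] amounts to a morphism K and a derivation D twisted by K. *)
Definition ut_mx (p d l : R) : 'M[R]_2 :=
  \matrix_(i, j) if i == 0 then (if j == 0 then p else d)
                 else (if j == 0 then 0 else l).

Lemma ut_mxM p d l p' d' l' :
  ut_mx p d l * ut_mx p' d' l' = ut_mx (p * p') (p * d' + d * l') (l * l').
Proof.
apply/matrixP=> i j; rewrite !mxE !big_ord_recl big_ord0 !mxE /=.
by case: i j => [[|[|//]] ?] [[|[|//]] ?] /=; rewrite ?(mulr0, mul0r, addr0, add0r).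
Qed.

Lemma ut_mxD p d l p' d' l' :
  ut_mx p d l + ut_mx p' d' l' = ut_mx (p + p') (d + d') (l + l').
Proof.
by apply/matrixP=> i j; rewrite !mxE; do 2?case: ifP => _; rewrite ?addr0.
Qed.

Lemma ut_mxZ c p d l :
  (c%:A)%:M * ut_mx p d l = ut_mx (c *: p) (c *: d) (c *: l).
Proof.
rewrite -mulmxE mul_scalar_mx; apply/matrixP=> i j; rewrite !mxE.
by do 2?case: ifP => _; rewrite ?mulr0 // -scalerAl mul1r.
Qed.

End UpperTriangular.

Definition adjacent n (a b : 'I_n) := (b == a.+1 :> nat) || (a == b.+1 :> nat).

Lemma adjacent_sym n (a b : 'I_n) : adjacent a b = adjacent b a.
Proof. exact: orbC. Qed.

Lemma adjacent_neq n (a b : 'I_n) : adjacent a b -> a != b.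
Proof. by case/orP=> /eqP e; rewrite -val_eqE /= e; lia. Qed.

Section Transvection.
Variables (K : comUnitRingType) (q : K) (n : nat) (R : algType K).
Variable x : 'I_n -> 'I_n -> R.
Hypothesis q_unit : q \is a GRing.unit.
Hypothesis x_row : forall i j l : 'I_n, (j < l)%N ->
  x i j * x i l = q^-1 *: (x i l * x i j).
Hypothesis x_col : forall i j l : 'I_n, (j < l)%N ->
  x j i * x l i = q^-1 *: (x l i * x j i).
Hypothesis x_comm : forall i j i' j' : 'I_n, (i < i')%N -> (j' < j)%N ->
  x i j * x i' j' = x i' j' * x i j.
Hypothesis x_cross : forall i j i' j' : 'I_n, (i < i')%N -> (j < j')%N ->
  x i j * x i' j' = x i' j' * x i j + (q^-1 - q) *: (x i' j * x i j').

(** Eigenvalue of the group-like element K on column [c]. Those at [a] and [b] are mutually inverse,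
    and the order of [a] and [b] decides which one is q^-1. *)
Definition tweight (a b c : 'I_n) : K :=
  if c == a then (if (a < b)%N then q^-1 else q)
  else if c == b then (if (a < b)%N then q else q^-1) else 1.

Definition transv_mx (a b : 'I_n) (u : 'I_n * 'I_n) : 'M[R]_2 :=
  ut_mx (tweight a b u.2 *: x u.1 u.2)
        (if u.2 == a then x u.1 b else 0) (x u.1 u.2).

Variables a b : 'I_n.
Hypothesis adj_ab : adjacent a b.

Let qV : q * q^-1 = 1. Proof. exact: mulrV. Qed.

Let ne_ab : a != b. Proof. exact: adjacent_neq. Qed.

Let wM c d (y z : R) : c *: y * (d *: z) = (c * d) *: (y * z).
Proof. by rewrite -scalerAl -scalerAr scalerA. Qed.

Let wE c : c != a -> c != b -> tweight a b c = 1.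
Proof. by rewrite /tweight => /negPf -> /negPf ->. Qed.

Let wa1 : (a < b)%N -> tweight a b a = q^-1.
Proof. by rewrite /tweight eqxx => ->. Qed.

Let wa2 : (b < a)%N -> tweight a b a = q.
Proof. by move=> ba; rewrite /tweight eqxx ltnNge ltnW. Qed.

Let wb1 : (a < b)%N -> tweight a b b = q.
Proof. by rewrite /tweight eq_sym (negPf ne_ab) eqxx => ->. Qed.

Let wb2 : (b < a)%N -> tweight a b b = q^-1.
Proof. by move=> ba; rewrite /tweight eq_sym (negPf ne_ab) eqxx ltnNge ltnW. Qed.

Local Notation f := (transv_mx a b).

(** This lemma and the next three check the defining relations entry by entry. On the diagonal the
    weights factor out. In the corner, a column other than [a] and [b] lies on the same side of
    both, so the relation persists with [b] in place of [a]; when the other column is [b], its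
    weight supplies the missing scalar. *)
Lemma transv_row (i j l : 'I_n) : (j < l)%N ->
  f (i, j) * f (i, l) = (q^-1%:A)%:M * (f (i, l) * f (i, j)).
Proof.
move=> lt; rewrite !ut_mxM ut_mxZ /=; congr ut_mx.
- by rewrite !wM x_row // !scalerA; congr (_ *: _); ring.
- case: (eqVneq j a) => [ja|neja].
    subst j; have nla : l != a by rewrite -val_eqE /=; lia.
    rewrite (negPf nla) mulr0 add0r mul0r addr0.
    case: (eqVneq l b) => [lb|nelb].
      by subst l; rewrite wb1 // -scalerAl scalerA mulrC qV scale1r.
    rewrite wE // scale1r x_row //.
    by move: adj_ab nelb; rewrite /adjacent -val_eqE /=; lia.
  rewrite mul0r mulr0 addr0 add0r.
  case: (eqVneq l a) => [la|nela]; last by rewrite mulr0 mul0r scaler0.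
  subst l; case: (eqVneq j b) => [jb|nejb].
    by subst j; rewrite wb2 // -scalerAl.
  rewrite wE // scale1r x_row //.
  by move: adj_ab nejb; rewrite /adjacent -val_eqE /=; lia.
- exact: x_row.
Qed.

Lemma transv_col (i j l : 'I_n) : (j < l)%N ->
  f (j, i) * f (l, i) = (q^-1%:A)%:M * (f (l, i) * f (j, i)).
Proof.
move=> lt; rewrite !ut_mxM ut_mxZ /=; congr ut_mx.
- by rewrite !wM x_col // !scalerA; congr (_ *: _); ring.
- case: (eqVneq i a) => [ia|_]; last by rewrite !(mulr0, mul0r, addr0, scaler0).
  (* Both generators lie in column [a], so D acts on each of them, and the crossing relation
     reorders one of the two resulting products. For a < b the scalars agree since q^-1 (q^-1 - q) +
     1 = q^-2. *)
  subst i; rewrite -!scalerAl; case: (ltngtP a b) => [ab|ba|/val_inj eab].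
  + rewrite (wa1 ab) (x_cross lt ab) -(x_comm lt ab).
    rewrite !scalerDr !scalerA -addrA [RHS]addrC; congr (_ + _).
    rewrite -[X in _ + X]scale1r -scalerDl; congr (_ *: _).
    by rewrite mulrBr mulVr // subrK.
  + rewrite (wa2 ba) (x_cross lt ba) -(x_comm lt ba).
    rewrite scalerDr scalerA mulrC qV scale1r addrC -addrA -scalerDl.
    by rewrite subrK.
  + by move: ne_ab; rewrite eab eqxx.
- exact: x_col.
Qed.

Lemma transv_comm (i j i' j' : 'I_n) : (i < i')%N -> (j' < j)%N ->
  f (i, j) * f (i', j') = f (i', j') * f (i, j).
Proof.
move=> lti ltj; rewrite !ut_mxM /=; congr ut_mx.
- by rewrite !wM x_comm // mulrC.
- case: (eqVneq j a) => [ja|neja].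
    subst j; have nja : j' != a by rewrite -val_eqE /=; lia.
    rewrite (negPf nja) mulr0 add0r mul0r addr0.
    case: (eqVneq j' b) => [jb|nejb].
      by subst j'; rewrite wb2 // -scalerAl x_col.
    rewrite wE // scale1r x_comm //.
    by move: adj_ab nejb; rewrite /adjacent -val_eqE /=; lia.
  rewrite mul0r mulr0 addr0 add0r.
  case: (eqVneq j' a) => [ja|nela]; last by rewrite mulr0 mul0r.
  subst j'; case: (eqVneq j b) => [jb|nejb].
    by subst j; rewrite wb1 // -scalerAl x_col // scalerA qV scale1r.
  rewrite wE // scale1r x_comm //.
  by move: adj_ab nejb; rewrite /adjacent -val_eqE /=; lia.
- exact: x_comm.
Qed.

Lemma transv_cross (i j i' j' : 'I_n) : (i < i')%N -> (j < j')%N ->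
  f (i, j) * f (i', j') =
  f (i', j') * f (i, j) + ((q^-1 - q)%:A)%:M * (f (i', j) * f (i, j')).
Proof.
move=> lti ltj; rewrite !ut_mxM ut_mxZ ut_mxD /=; congr ut_mx.
- rewrite !wM x_cross // scalerDr !scalerA mulrC; congr (_ + _ *: _).
  by ring.
- case: (eqVneq j a) => [ja|neja].
    subst j; have nja : j' != a by rewrite -val_eqE /=; lia.
    rewrite (negPf nja) !mulr0 mul0r addr0 !add0r.
    case: (eqVneq j' b) => [jb|nejb].
      subst j'; rewrite wb1 // -scalerAl -scalerDl x_col //.
      by rewrite addrC subrK.
    rewrite wE // scale1r x_cross //.
    by move: adj_ab nejb; rewrite /adjacent -val_eqE /=; lia.
  rewrite mul0r mulr0 addr0 add0r.
  case: (eqVneq j' a) => [ja|nela]; last by rewrite !(mulr0, mul0r, addr0, scaler0).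
  subst j'; rewrite mul0r addr0; case: (eqVneq j b) => [jb|nejb].
    subst j; rewrite wb2 // -!scalerAl x_col // !scalerA.
    rewrite -[X in _ = X + _]scale1r -scalerDl; congr (_ *: _).
    by rewrite mulrBl qV addrC subrK.
  rewrite wE // !scale1r x_cross //.
  by move: adj_ab nejb; rewrite /adjacent -val_eqE /=; lia.
- exact: x_cross.
Qed.

End Transvection.

(** Scalars of k_q give central scalar matrices, so [qmat_lift] applies. The conclusion is the
    hypothesis [transvection] under which later sections treat abstract generators [x]. *)
Lemma qmat_transvection (k : fieldType) (n : nat) (a b : 'I_n) :
  adjacent a b -> exists Phi : {rmorphism qmat k n -> 'M[qmat k n]_2},
  (forall i c, Phi (xgen k i c) = transv_mx (qvar k) (@xgen k n) a b (i, c)) /\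
  (forall c y i j, Phi (c *: y) i j = c *: Phi y i j).
Proof.
move=> adj_ab.
pose iota : {rmorphism laurent k -> 'M[qmat k n]_2} :=
  (@scalar_mx (qmat k n) 2) \o in_alg (qmat k n).
have iotaE c (y : 'M_2) i j : (iota c * y) i j = c *: y i j.
  by rewrite /iota /= -mulmxE mul_scalar_mx mxE -scalerAl mul1r.
have central c (y : 'M_2) : GRing.comm (iota c) y.
  apply/matrixP=> i j; apply: etrans (iotaE _ _ _ _) _.
  by apply: etrans _ (esym (mulmx_scalarE _ _ _ _)); rewrite -scalerAr mulr1.
have [||||Phi [PhiX PhiZ]] := @qmat_lift k n _ iota
  (transv_mx (qvar k) (@xgen k n) a b) central.
- exact: (transv_row (qvar_unit k) (@xgen_row k n) adj_ab).
- exact: (transv_col (qvar_unit k) (@xgen_col k n) (@xgen_comm k n)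
    (@xgen_cross k n) adj_ab).
- exact: (transv_comm (qvar_unit k) (@xgen_col k n) (@xgen_comm k n) adj_ab).
- exact: (transv_cross (qvar_unit k) (@xgen_col k n) (@xgen_cross k n) adj_ab).
exists Phi; split=> [i c|c y i j]; first exact: PhiX.
by rewrite PhiZ; exact: iotaE.
Qed.

(** * The transvections on quantum minors *)

Section SwapInversions.
Variables (x y : nat).
Hypothesis lt_xy : (x < y)%N.

Definition swap_nat (c : nat) := if c == x then y else if c == y then x else c.

Let count_swap (u : seq nat) c :
  c != x -> c != y -> ~~ (x < c < y)%N ->
  count (ltn^~ c) (map swap_nat u) = count (ltn^~ c) u.
Proof.
move=> cx cy nc; rewrite count_map; apply: eq_count => d /=.
by rewrite /swap_nat; do !case: eqP => //; lia.
Qed.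

Let count_noswap (u : seq nat) c : c = x \/ c = y ->
  {in u, forall d, ~~ (x < d < y)%N} -> x \notin u -> y \notin u ->
  count (ltn^~ (swap_nat c)) (map swap_nat u) = count (ltn^~ c) u.
Proof.
move=> cxy nb xu yu; rewrite count_map; apply: eq_in_count => d du /=.
have := nb d du; have dx : d != x by apply: contraNneq xu => <-.
have dy : d != y by apply: contraNneq yu => <-.
by rewrite /swap_nat (negPf dx) (negPf dy); case: cxy => ->; do !case: eqP; lia.
Qed.

(** With no entry strictly between [x] and [y], and at most one of them present, the swap preserves
    the order of the entries. *)
Lemma inversions_swap_out u : uniq u -> {in u, forall d, ~~ (x < d < y)%N} ->
  ~~ ((x \in u) && (y \in u)) -> inversions (map swap_nat u) = inversions u.
Proof.
elim: u => [//|c u IHu] /= /andP [cu uu] nb nxy.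
have nbu : {in u, forall d, ~~ (x < d < y)%N}.
  by move=> d du; apply: nb; rewrite inE du orbT.
rewrite IHu //; last first.
  by apply: contra nxy; rewrite !inE => /andP [-> ->]; rewrite !orbT.
congr (_ + _)%N; case: (eqVneq c x) => [cx|ncx].
  apply: count_noswap => //; first by left.
    by rewrite -cx.
  by apply: contra nxy => yu; rewrite !inE yu cx eqxx orbT.
case: (eqVneq c y) => [cy|ncy].
  apply: count_noswap => //; first by right.
    by apply: contra nxy => xu; rewrite !inE xu cy eqxx orbT.
  by rewrite -cy.
rewrite /swap_nat (negPf ncx) (negPf ncy) -/swap_nat count_swap //.
exact/nb/mem_head.
Qed.

(** Only the comparison of [x] with [y] is reversed. *)
Lemma inversions_swap u : uniq u -> {in u, forall d, ~~ (x < d < y)%N} ->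
  x \in u -> y \in u -> (index x u < index y u)%N ->
  inversions (map swap_nat u) = (inversions u).+1.
Proof.
elim: u => [//|c u IHu] /= /andP [cu uu] nb.
have nbu : {in u, forall d, ~~ (x < d < y)%N}.
  by move=> d du; apply: nb; rewrite inE du orbT.
rewrite !inE; case: (eqVneq c x) => [cx|ncx] /=.
  subst c; case: (eqVneq x y) => [|nxy] /=; first by lia.
  move=> _ yu _; rewrite inversions_swap_out // ?(negPf cu) //.
  rewrite -addSn; congr (_ + _)%N.
  have -> : swap_nat x = y by rewrite /swap_nat eqxx.
  (* With [x] at the head, the entries below [y] after the swap are those that were below [x], and
     the image of [y]. *)
  have -> : (count (ltn^~ x) u).+1 =
            (count (ltn^~ x) u + count (pred1 y) u)%N.
    by rewrite [X in (_ + X)%N]count_uniq_mem // yu addn1.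
  rewrite count_map -count_predUI -[LHS]addn0; congr (_ + _)%N.
    apply: eq_in_count => d du /=; have := nbu d du.
    have : d != x by apply: contraNneq cu => <-.
    by rewrite /swap_nat; do !case: eqP; lia.
  apply/esym/eqP; rewrite eqn0Ngt -has_count; apply/negP => /hasP [d du] /=.
  by case: eqP; lia.
case: (eqVneq c y) => [|ncy] //= xu yu ltxy.
rewrite IHu // addnS; congr (_ + _).+1.
rewrite /swap_nat (negPf ncx) (negPf ncy) -/swap_nat count_swap //.
exact/nb/mem_head.
Qed.

End SwapInversions.

(** * The matrix morphism evaluated on a quantum minor *)

Section Minors.
Variables (K : comUnitRingType) (q : K) (n : nat) (R : algType K).
Variable x : 'I_n -> 'I_n -> R.
Hypothesis q_unit : q \is a GRing.unit.

(** Indexing rows and columns by functions makes replacing a column a composition with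
    [merge_col]. *)
Definition fminor p (r c : 'I_p -> 'I_n) : R :=
  \sum_(sigma : 'S_p) (- q) ^- inv_perm sigma *:
    \prod_(i < p) x (r i) (c (sigma i)).

Definition wmon (s : seq ('I_n * 'I_n)) : R := \prod_(u <- s) x u.1 u.2.

Lemma wmon_cons u s : wmon (u :: s) = x u.1 u.2 * wmon s.
Proof. exact: big_cons. Qed.

Definition word_of p (r c : 'I_p -> 'I_n) (sigma : 'S_p) :=
  [seq (r i, c (sigma i)) | i <- enum 'I_p].

Lemma fminorE p (r c : 'I_p -> 'I_n) :
  fminor r c =
  \sum_(sigma : 'S_p) (- q) ^- inv_perm sigma *: wmon (word_of r c sigma).
Proof.
apply: eq_bigr => sigma _; rewrite /wmon big_map enumT.
by rewrite [index_enum _]unlock.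
Qed.

Lemma cols_word_of p (r c : 'I_p -> 'I_n) (sigma : 'S_p) :
  unzip2 (word_of r c sigma) = map c (map sigma (enum 'I_p)).
Proof. by rewrite /unzip2 -!map_comp. Qed.

Variables a b : 'I_n.
Hypothesis adj_ab : adjacent a b.
Variable Phi : {rmorphism R -> 'M[R]_2}.
Hypothesis PhiX : forall i c, Phi (x i c) = transv_mx q x a b (i, c).
Hypothesis PhiZ : forall c y i j, Phi (c *: y) i j = c *: Phi y i j.

Local Notation tw := (tweight q a b).
Definition merge_col (c : 'I_n) := if c == a then b else c.
(** The scalar that K contributes on the letters to the left of column [a]: when columns are
    distinct, only a letter in column [b] can have a weight other than 1. *)
Definition merge_factor (cs : seq 'I_n) : K :=
  if (index b cs < index a cs)%N then tw b else 1.

Lemma Phi_wmon s : uniq (unzip2 s) ->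
  Phi (wmon s) = ut_mx ((\prod_(c <- unzip2 s) tw c) *: wmon s)
    (if a \in unzip2 s then merge_factor (unzip2 s) *:
       wmon [seq (u.1, merge_col u.2) | u <- s] else 0) (wmon s).
Proof.
have ne_ab := adjacent_neq adj_ab.
elim: s => [_|[i c] s IHs] /=.
  rewrite /wmon !big_nil rmorph1 scale1r.
  by apply/matrixP=> i j; rewrite !mxE; case: i j => [[|[|//]] ?] [[|[|//]] ?].
move=> /andP [cs us]; rewrite wmon_cons rmorphM IHs // PhiX.
rewrite ut_mxM /= !wmon_cons big_cons /=; congr ut_mx.
  by rewrite -scalerAl -scalerAr scalerA.
(* If the head is in column [a], nothing stands to its left and the tail is untouched by D;
   otherwise K acts on the head and D on the tail. *)
rewrite inE /= eq_sym; case: (eqVneq c a) => [ca|nca] /=.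
  rewrite -ca (negPf cs) mulr0 add0r /merge_factor /= -ca eqxx ltn0 scale1r.
  rewrite ca /merge_col eqxx; congr (_ * _); rewrite /wmon big_map.
  apply: eq_big_seq => -[i' c'] /= us'; case: (eqVneq c' a) => // ca'.
  by move: cs; rewrite ca -ca' (map_f snd us').
rewrite mul0r addr0; case: ifP => [acs|_]; last by rewrite mulr0.
rewrite -scalerAl -scalerAr scalerA; congr (_ *: (_ * _)); last first.
  by rewrite /merge_col (negPf nca).
rewrite /merge_factor /= (negPf nca); case: (eqVneq c b) => [cb|ncb].
  rewrite ltn0Sn -cb [X in (X < _)%N]memNindex // ltnNge index_size.
  by rewrite mulr1 cb.
by rewrite ltnS /tweight (negPf nca) (negPf ncb) mul1r.
Qed.

Variables (p : nat) (r c : 'I_p -> 'I_n).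
Hypothesis c_inj : injective c.

Let ucols (sigma : 'S_p) : uniq (unzip2 (word_of r c sigma)).
Proof.
by rewrite cols_word_of (map_inj_uniq c_inj) (map_inj_uniq perm_inj) enum_uniq.
Qed.

Let mem_cols (sigma : 'S_p) d :
  (d \in unzip2 (word_of r c sigma)) = (d \in codom c).
Proof.
rewrite cols_word_of; apply/mapP/codomP => [[j _ ->]|[j ->]]; exists j => //.
by apply/mapP; exists ((sigma^-1)%g j); rewrite ?permKV // mem_enum.
Qed.

(** Every word of the minor runs through the same columns, so K multiplies all of them by one
    scalar. *)
Lemma Phi_fminor_diag :
  [/\ Phi (fminor r c) 0 0 = (\prod_j tw (c j)) *: fminor r c,
      Phi (fminor r c) 1 0 = 0 & Phi (fminor r c) 1 1 = fminor r c].
Proof.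
split; rewrite fminorE rmorph_sum summxE ?scaler_sumr;
  [apply: eq_bigr|apply: big1|apply: eq_bigr] => sigma _;
  rewrite PhiZ Phi_wmon // mxE //= ?scaler0 //.
rewrite !scalerA mulrC; congr (_ * _ *: _).
rewrite cols_word_of 2!big_map enumT [RHS](reindex_inj (@perm_inj _ sigma)) /=.
by rewrite [index_enum _]unlock.
Qed.

Lemma Phi_fminor01 : Phi (fminor r c) 0 1 =
  if a \in codom c then \sum_(sigma : 'S_p) (- q) ^- inv_perm sigma *:
    (merge_factor (map c (map sigma (enum 'I_p))) *:
     wmon (word_of r (merge_col \o c) sigma)) else 0.
Proof.
rewrite fminorE rmorph_sum summxE.
case: ifP => ac; [apply: eq_bigr|apply: big1] => sigma _;
  rewrite PhiZ Phi_wmon // mxE /= mem_cols ac ?scaler0 //.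
by rewrite -(cols_word_of r) /word_of -map_comp.
Qed.

Lemma Phi_fminor_out : a \notin codom c -> Phi (fminor r c) 0 1 = 0.
Proof. by move=> ac; rewrite Phi_fminor01 (negPf ac). Qed.

(** With column [b] absent every merging factor is 1. *)
Lemma Phi_fminor_replace : a \in codom c -> b \notin codom c ->
  Phi (fminor r c) 0 1 = fminor r (merge_col \o c).
Proof.
move=> ac bc; rewrite Phi_fminor01 ac fminorE; apply: eq_bigr => sigma _.
rewrite /merge_factor ltnNge (leq_trans (index_size _ _)) ?scale1r //.
by rewrite -(cols_word_of r) memNindex ?mem_cols.
Qed.

(* Exchanging the columns a and b in sigma multiplies the coefficient by
   - q^-1 or - q, which the weight of the transvection compensates. *)
Lemma Phi_fminor_both (ja jb : 'I_p) : c ja = a -> c jb = b ->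
  (if (a < b)%N then jb == ja.+1 :> nat else ja == jb.+1 :> nat) ->
  Phi (fminor r c) 0 1 = 0.
Proof.
move=> cja cjb jab; have ne_ab := adjacent_neq adj_ab.
have ne_j : ja != jb by apply: contra_neq ne_ab => e; rewrite -cja -cjb e.
rewrite Phi_fminor01 -cja codom_f.
pose t := tperm ja jb; pose vals (sigma : 'S_p) := [seq val (sigma i) | i <- enum 'I_p].
have t_cols (sigma : 'S_p) : [seq (sigma * t)%g i | i <- enum 'I_p] =
    map t (map sigma (enum 'I_p)).
  by rewrite -(map_comp t sigma); apply: eq_map => i; rewrite /= permM.
have uvals (sigma : 'S_p) : uniq (vals sigma).
  rewrite map_inj_uniq ?enum_uniq //.
  by move=> i j /val_inj; exact: perm_inj.
have mvals (sigma : 'S_p) (j : 'I_p) : val j \in vals sigma.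
  by apply/mapP; exists ((sigma^-1)%g j); rewrite ?permKV // mem_enum.
pose P (sigma : 'S_p) := (index (val jb) (vals sigma) < index (val ja) (vals sigma))%N.
have mfE (sigma : 'S_p) : merge_factor (map c (map sigma (enum 'I_p))) =
    if P sigma then tw b else 1.
  rewrite /merge_factor -cja -cjb !index_map // /P /vals.
  by rewrite (map_comp val sigma) !index_map //; exact: val_inj.
have vE (sigma : 'S_p) (j : 'I_p) : index (val j) (vals sigma) = index j (map sigma (enum 'I_p)).
  by rewrite /vals (map_comp val sigma) index_map //; exact: val_inj.
have index_t (sigma : 'S_p) (j : 'I_p) :
    index (val j) (vals (sigma * t)%g) = index (val (t j)) (vals sigma).
  by rewrite !vE t_cols -[j in LHS](tpermK ja jb) index_map //; exact: perm_inj.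
have P_t (sigma : 'S_p) : P (sigma * t)%g = ~~ P sigma.
  rewrite /P !index_t /t tpermL tpermR -leqNgt ltn_neqAle.
  case: eqP => // e; case/negP: ne_j; apply/eqP/val_inj.
  exact: (index_inj 0%N (mvals sigma ja) (mvals sigma jb) e).
(* The sum is split according to whether [b] stands to the left of [a], and [sigma * t] matches the
   two halves. *)
rewrite (bigID P) /= [X in _ + X](reindex_inj (mulIg t)) /=.
rewrite [X in _ + X](eq_bigl P) => [|sigma]; last by rewrite P_t negbK.
rewrite -big_split; apply: big1 => sigma Ps /=.
rewrite !mfE Ps P_t Ps /= scale1r.
(* Once [a] is merged into [b] the two words coincide, so only their coefficients have to cancel. *)
have -> : word_of r (merge_col \o c) (sigma * t)%g = word_of r (merge_col \o c) sigma.
  apply: eq_map => i /=; congr (_, _); rewrite permM /t.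
  by case: tpermP => // ->; rewrite cja cjb /merge_col eqxx eq_sym (negPf ne_ab).
rewrite scalerA -scalerDl; set w := wmon _.
suff -> : (- q) ^- inv_perm sigma * tw b + (- q) ^- inv_perm (sigma * t)%g = 0.
  by rewrite scale0r.
have nqV : (- q)^-1 = - q^-1 by rewrite invrN.
have NqU : - q \is a GRing.unit by rewrite unitrN.
(* For a < b the columns [a] and [b] form an inversion of [sigma], which has one more than
   [sigma * t]; for b < a it has one fewer. No other inversion changes, as [ja] and [jb] are
   consecutive positions. *)
case: ltnP jab => [lt_ab|le_ba] /eqP jE.
  have lt_j : (ja < jb)%N by rewrite jE.
  have nb : {in vals (sigma * t)%g, forall d, ~~ (ja < d < jb)%N}.
    by move=> d _; rewrite jE; lia.
  have inv_s : inv_perm sigma = (inv_perm (sigma * t)%g).+1.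
    rewrite /inv_perm -(inversions_swap lt_j (uvals _) nb) ?mvals //; last first.
      by rewrite !index_t /t tpermL tpermR.
    congr inversions; rewrite -(map_comp _ (fun i => val ((sigma * t)%g i))).
    apply: eq_map => i /=; rewrite permM /t.
    case: tpermP => [->|->|/eqP + /eqP].
    - by rewrite /swap_nat gtn_eqF ?eqxx.
    - by rewrite /swap_nat eqxx.
    - by rewrite -!val_eqE /swap_nat /= => /negPf -> /negPf ->.
  rewrite inv_s /tweight eq_sym (negPf ne_ab) eqxx lt_ab exprS invrM ?unitrX //.
  by rewrite nqV mulrN mulNr -mulrA mulVr // mulr1 addNr.
have lt_j : (jb < ja)%N by rewrite jE.
have nb : {in vals sigma, forall d, ~~ (jb < d < ja)%N}.
  by move=> d _; rewrite jE; lia.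
have inv_t : inv_perm (sigma * t)%g = (inv_perm sigma).+1.
  rewrite /inv_perm -(inversions_swap lt_j (uvals _) nb) ?mvals //.
  congr inversions; rewrite -(map_comp _ (fun i => val (sigma i))).
  apply: eq_map => i /=; rewrite permM /t.
  case: tpermP => [->|->|/eqP + /eqP].
  - by rewrite /swap_nat gtn_eqF ?eqxx.
  - by rewrite /swap_nat eqxx.
  - by rewrite -!val_eqE /swap_nat /= => /negPf -> /negPf ->.
rewrite inv_t /tweight eq_sym (negPf ne_ab) eqxx ltnNge le_ba /= exprS.
by rewrite invrM ?unitrX // nqV mulrN subrr.
Qed.

End Minors.

(** * Column sets and their transpositions *)

Section IncreasingSeq.
Variable n : nat.
Implicit Types (X Y : {set 'I_n}) (a b : 'I_n).

Lemma enum_increasing X : increasing (enum X).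
Proof.
rewrite /increasing sorted_map; apply: sorted_filter => [i j l /=|].
  exact: ltn_trans.
by rewrite -sorted_map -enumT val_enum_ord iota_ltn_sorted.
Qed.

Lemma increasing_eq (s t : seq 'I_n) :
  increasing s -> increasing t -> s =i t -> s = t.
Proof.
rewrite /increasing !sorted_map; apply: irr_sorted_eq => [i j l|i] /=.
  exact: ltn_trans.
exact: ltnn.
Qed.

(** A preimage, which is also the image because the transposition is an involution; membership then
    unfolds by [inE]. *)
Definition swap_set a b X := [set c | tperm a b c \in X].

Lemma swap_setC a b X : swap_set a b X = swap_set b a X.
Proof. by rewrite /swap_set tpermC. Qed.

Lemma swap_setK a b : involutive (swap_set a b).
Proof. by move=> X; apply/setP=> c; rewrite !inE tpermK. Qed.

Lemma card_swap_set a b X : #|swap_set a b X| = #|X|.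
Proof.
have -> : swap_set a b X = tperm a b @: X.
  apply/setP=> c; rewrite inE; apply/idP/imsetP => [cX|[d dX ->]].
    by exists (tperm a b c); rewrite ?tpermK.
  by rewrite tpermK.
by rewrite card_imset //; exact: perm_inj.
Qed.

Lemma swap_set_id a b X : (a \in X) = (b \in X) -> swap_set a b X = X.
Proof.
by move=> ab; apply/setP=> c; rewrite inE; case: tpermP => [->|->|].
Qed.

Lemma swap_setU a b X Y :
  swap_set a b (X :|: Y) = swap_set a b X :|: swap_set a b Y.
Proof. by apply/setP=> c; rewrite !inE. Qed.

Lemma swap_setI a b X Y :
  swap_set a b (X :&: Y) = swap_set a b X :&: swap_set a b Y.
Proof. by apply/setP=> c; rewrite !inE. Qed.

Lemma swap_set_conj u v w X : v != u -> v != w ->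
  swap_set u w (swap_set v u (swap_set u w X)) = swap_set v w X.
Proof.
move=> vu vw; apply/setP=> c; rewrite !inE; congr (_ \in X).
have := tpermJ v u (tperm u w); rewrite tpermL tpermD 1?eq_sym // => <-.
by rewrite conjgE tpermV !permM.
Qed.

(** No column lies strictly between adjacent ones, so relabelling [a] as [b] keeps the enumeration
    increasing. *)
Lemma enum_swap_set a b X : adjacent a b -> a \in X -> b \notin X ->
  enum (swap_set a b X) = map (merge_col a b) (enum X).
Proof.
move=> adj aX bX; apply: increasing_eq; first exact: enum_increasing.
  have inc := enum_increasing X.
  move: inc; rewrite /increasing !sorted_map.
  apply: (sub_in_sorted (P := mem X)); last first.
    by apply/allP=> c; rewrite mem_enum.
  move=> c d cX dX /=; rewrite /merge_col.
  have cb : c != b by apply: contraNneq bX => <-.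
  have db : d != b by apply: contraNneq bX => <-.
  move: adj cb db; rewrite /adjacent -!val_eqE.
  move=> /= ab cb db.
  case: (nat_of_ord c =P a) => ca; case: (nat_of_ord d =P a) => da; lia.
move=> c; rewrite mem_enum inE; apply/idP/mapP => [cX|[d]].
  exists (tperm a b c); first by rewrite mem_enum.
  rewrite /merge_col; case: tpermP => [ca|->|/eqP ca _].
  - by move: cX; rewrite ca tpermL (negPf bX).
  - by rewrite eqxx.
  - by rewrite (negPf ca).
rewrite mem_enum /merge_col => dX ->; case: eqP => [da|/eqP nda].
  by rewrite tpermR.
by rewrite tpermD // eq_sym //; apply: contraNneq bX => <-.
Qed.

Lemma index_enum_succ X (u v : 'I_n) : u \in X -> v \in X ->
  v = u.+1 :> nat -> index v (enum X) = (index u (enum X)).+1.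
Proof.
rewrite -!(mem_enum X) => uX vX vu; have inc := enum_increasing X.
have lt_nth i j : (i < j < size (enum X))%N ->
    (nth u (enum X) i < nth u (enum X) j)%N.
  move=> /andP [lt_ij lt_j]; move: inc; rewrite /increasing sorted_map => inc.
  apply: (sorted_ltn_nth (leT := relpre val ltn) _ _ inc) => //.
  - by move=> ? ? ?; exact: ltn_trans.
  - by rewrite inE (ltn_trans lt_ij).
have iv := index_mem v (enum X); have iu := index_mem u (enum X).
rewrite uX in iu; rewrite vX in iv.
have nu := nth_index u uX; have nv := nth_index u vX.
case: (ltngtP (index v (enum X)) (index u (enum X)).+1) => // lt.
  move: (lt); rewrite ltnS leq_eqVlt => /orP [/eqP e|lt'].
    by move: nv; rewrite e nu => uv; move: vu; rewrite uv; lia.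
  have := lt_nth (index v (enum X)) (index u (enum X)).
  by rewrite lt' iu nu nv => /(_ isT); lia.
have h1 := lt_nth (index u (enum X)) (index u (enum X)).+1.
have h2 := lt_nth (index u (enum X)).+1 (index v (enum X)).
rewrite ltnSn (ltn_trans lt iv) nu in h1; rewrite lt iv nv in h2.
by have := h1 isT; have := h2 isT; lia.
Qed.

End IncreasingSeq.

(** * Column exchanges and Hecke generators on products of two minors *)

Section SetMinors.
Variables (K : comUnitRingType) (q : K) (n : nat) (R : algType K).
Variable x : 'I_n -> 'I_n -> R.
Hypothesis q_unit : q \is a GRing.unit.
Hypothesis transvection : forall a b : 'I_n, adjacent a b ->
  exists Phi : {rmorphism R -> 'M[R]_2},
  (forall i c, Phi (x i c) = transv_mx q x a b (i, c)) /\
  (forall c y i j, Phi (c *: y) i j = c *: Phi y i j).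
Implicit Types (A B : seq 'I_n) (X Y U C : {set 'I_n}).

(** Same body as [qminor], over abstract generators, so that the two agree by conversion. *)
Definition minor A B : R :=
  \sum_(sigma : 'S_(size A))
    (- q) ^- inv_perm sigma *:
      \prod_(i < size A)
        (let a := tnth (in_tuple A) i in x a (nth a B (sigma i))).

Definition sminor A X := minor A (enum X).

Let col A B (j : 'I_(size A)) := nth (tnth (in_tuple A) j) B j.

Lemma minor_fminor A B : size B = size A ->
  minor A B = fminor q x (tnth (in_tuple A)) (@col A B).
Proof.
move=> szB; apply: eq_bigr => sigma _; congr (_ *: _).
apply: eq_bigr => i _; congr (x _ _); apply: set_nth_default.
by rewrite szB.
Qed.

Let col_inj A B : size B = size A -> uniq B -> injective (@col A B).
Proof.
move=> szB uB i j; rewrite /col (set_nth_default (tnth (in_tuple A) j)) ?szB //.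
by move/eqP; rewrite nth_uniq ?szB // => /eqP /val_inj.
Qed.

Let mem_col A B c : size B = size A -> (c \in codom (@col A B)) = (c \in B).
Proof.
move=> szB; apply/codomP/idP => [[j ->]|cB].
  by rewrite /col mem_nth ?szB.
have lt_c : (index c B < size A)%N by rewrite -szB index_mem.
by exists (Ordinal lt_c); rewrite /col nth_index.
Qed.

(** The scalar by which K acts on a minor with column set [X]. *)
Definition set_weight a b X : K :=
  (if a \in X then tweight q a b a else 1) *
  (if b \in X then tweight q a b b else 1).

Lemma prod_tweight a b A X : a != b -> #|X| = size A ->
  \prod_j tweight q a b (@col A (enum X) j) = set_weight a b X.
Proof.
move=> ne_ab szX; have szE : size (enum X) = size A by rewrite -cardE.
have -> : \prod_j tweight q a b (@col A (enum X) j) = \prod_(c <- enum X) tweight q a b c.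
  case: (posnP (size A)) => [A0|A_gt0].
    rewrite big1 => [|j _]; last by have := ltn_ord j; rewrite {2}A0.
    have /size0nil -> : size (enum X) = 0%N by rewrite szE.
    by rewrite big_nil.
  pose x0 := tnth (in_tuple A) (Ordinal A_gt0).
  rewrite (big_nth x0) big_mkord szE; apply: eq_bigr => j _.
  by congr tweight; apply: set_nth_default; rewrite szE.
rewrite big_enum /= big_mkcond (bigD1 a) //= (bigD1 b) /= 1?eq_sym //.
rewrite mulrA [X in _ * X]big1 ?mulr1 // => c /andP [ca cb].
by rewrite /tweight (negPf ca) (negPf cb) if_same.
Qed.

Definition dminor a b A X : R :=
  if (a \in X) && (b \notin X) then sminor A (swap_set a b X) else 0.

Lemma Phi_sminor (a b : 'I_n) (Phi : {rmorphism R -> 'M[R]_2}) A X :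
  adjacent a b ->
  (forall i c, Phi (x i c) = transv_mx q x a b (i, c)) ->
  (forall c y i j, Phi (c *: y) i j = c *: Phi y i j) ->
  #|X| = size A ->
  Phi (sminor A X) =
    ut_mx (set_weight a b X *: sminor A X) (dminor a b A X) (sminor A X).
Proof.
move=> adj PhiX PhiZ szX; have szE : size (enum X) = size A by rewrite -cardE.
have uE := enum_uniq X; have c_inj := col_inj szE uE.
have [p00 p10 p11] := Phi_fminor_diag adj PhiX PhiZ (tnth (in_tuple A)) c_inj.
have p01 : Phi (fminor q x (tnth (in_tuple A)) (@col A (enum X))) 0 1 = dminor a b A X.
  rewrite /dminor; case aX: (a \in X); last first.
    by apply: (Phi_fminor_out adj PhiX PhiZ) => //; rewrite mem_col // mem_enum aX.
  case bX: (b \in X) => /=.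
    have aE : a \in enum X by rewrite mem_enum.
    have bE : b \in enum X by rewrite mem_enum.
    have lt_a : (index a (enum X) < size A)%N by rewrite -szE index_mem.
    have lt_b : (index b (enum X) < size A)%N by rewrite -szE index_mem.
    apply: (Phi_fminor_both q_unit adj PhiX PhiZ _ c_inj
      (ja := Ordinal lt_a) (jb := Ordinal lt_b)); rewrite /col ?nth_index //=.
    case: ifP => lt_ab; apply/eqP/index_enum_succ => //;
      by move: adj lt_ab; rewrite /adjacent; clear; lia.
  rewrite (Phi_fminor_replace adj PhiX PhiZ) //; last 2 first.
  - by rewrite mem_col // mem_enum.
  - by rewrite mem_col // mem_enum bX.
  rewrite /sminor minor_fminor; last by rewrite -cardE card_swap_set.
  apply: eq_bigr => sigma _; congr (_ *: _); apply: eq_bigr => i _.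
  congr (x _ _); rewrite /= /col enum_swap_set ?bX //.
  by rewrite (nth_map (tnth (in_tuple A) (sigma i))) ?szE.
rewrite /sminor minor_fminor //; apply/matrixP=> i j; rewrite mxE.
case: i j => [[|[|//]] hi] [[|[|//]] hj] /=.
- rewrite -(prod_tweight (adjacent_neq adj) szX) -p00.
  by congr (Phi _ _ _); apply: val_inj.
- by rewrite -p01; congr (Phi _ _ _); apply: val_inj.
- by rewrite -p10; congr (Phi _ _ _); apply: val_inj.
- by rewrite -[RHS]p11; congr (Phi _ _ _); apply: val_inj.
Qed.

(** D reads off the corner entry of the matrix morphism. *)
Lemma exists_derivation (a b : 'I_n) : adjacent a b ->
  exists D : {linear R -> R}, forall A B X Y, #|X| = size A -> #|Y| = size B ->
  D (sminor A X * sminor B Y) =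
    dminor a b A X * sminor B Y
    + set_weight a b X *: (sminor A X * dminor a b B Y).
Proof.
move=> adj; have [Phi [PhiX PhiZ]] := transvection adj.
pose d y := Phi y 0 1.
have d_lin : linear d by move=> c y z; rewrite /d rmorphD mxE PhiZ.
pose D : {linear R -> R} := HB.pack d (GRing.isLinear.Build K R R *:%R d d_lin).
exists D => A B X Y szX szY; rewrite /= /d rmorphM.
rewrite (Phi_sminor adj PhiX PhiZ szX) (Phi_sminor adj PhiX PhiZ szY).
by rewrite ut_mxM mxE /= addrC -scalerAl.
Qed.

Lemma tweight_mul (a b : 'I_n) : adjacent a b -> tweight q a b a * tweight q a b b = 1.
Proof.
move=> /adjacent_neq ne_ab; rewrite /tweight eqxx eq_sym (negPf ne_ab) eqxx.
by case: ifP => _; rewrite ?mulVr ?mulrV.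
Qed.

(** One of the two sets contains [a] and not [b]; the other contains both or neither, so D kills its
    minor, the exchange fixes it, and its weight is 1. *)
Lemma exists_swap (a b : 'I_n) : adjacent a b ->
  exists D : {linear R -> R}, forall A B X Y, #|X| = size A -> #|Y| = size B ->
  ((a \in X) + (a \in Y) = ((b \in X) + (b \in Y)).+1)%N ->
  D (sminor A X * sminor B Y) =
    sminor A (swap_set a b X) * sminor B (swap_set a b Y).
Proof.
move=> adj; have [D DE] := exists_derivation adj; exists D => A B X Y szX szY.
rewrite DE // /dminor /set_weight.
have := @swap_set_id n a b X; have := @swap_set_id n a b Y.
have tab := tweight_mul adj.
case: (a \in X); case: (a \in Y); case: (b \in X); case: (b \in Y) => sY sX //= _;
  rewrite ?tab ?mulr1 ?scale1r ?mulr0 ?mul0r ?scaler0 ?addr0 ?add0r;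
  try rewrite (sX erefl); try rewrite (sY erefl); by [].
Qed.

(* T is the Hecke generator of (v w); columns between v and w that lie in C or
   outside U are moved out of the way by conjugating with exists_swap. *)
Lemma exists_hecke (v w : 'I_n) U C : (v < w)%N ->
  v \in U :\: C -> w \in U :\: C ->
  (forall u : 'I_n, (v < u < w)%N -> u \in U -> u \in C) ->
  exists T : {linear R -> R}, forall A B X Y, #|X| = size A -> #|Y| = size B ->
  X :|: Y = U -> X :&: Y = C ->
  let XY := sminor A X * sminor B Y in
  let XY' := sminor A (swap_set v w X) * sminor B (swap_set v w Y) in
  [/\ v \in X -> w \notin X -> T XY = XY',
      v \notin X -> w \in X -> T XY = XY' - (q^-1 - q) *: XY
    & (v \in X) = (w \in X) -> T XY = - q^-1 *: XY].
Proof.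
move: {2}(w - v)%N (leqnn (w - v)%N) => d; elim: d w U C => [|d IHd] w U C.
  by move=> le0 lt; lia.
move=> le_d lt_vw vU wU btw.
case: (eqVneq (v.+1) w) => [vw|nvw].
  have adj : adjacent v w by rewrite /adjacent -vw eqxx.
  have adj' : adjacent w v by rewrite adjacent_sym.
  have [D1 D1E] := exists_derivation adj; have [D2 D2E] := exists_derivation adj'.
  pose t y := q^-1 *: D2 (D1 y) - q^-1 *: y.
  have t_lin : linear t.
    move=> c y z; rewrite /t 2!linearP /= !scalerDr !scalerN opprD addrACA.
    by rewrite !scalerA [q^-1 * c]mulrC.
  pose T : {linear R -> R} := HB.pack t (GRing.isLinear.Build K R R *:%R t t_lin).
  exists T => A B X Y szX szY XU YC XY XY'.
  have ne_vw := adjacent_neq adj.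
  have tv1 : tweight q v w v = q^-1 by rewrite /tweight eqxx lt_vw.
  have tw1 : tweight q v w w = q by rewrite /tweight eq_sym (negPf ne_vw) eqxx lt_vw.
  have tw2 : tweight q w v w = q by rewrite /tweight eqxx ltnNge ltnW.
  have tv2 : tweight q w v v = q^-1.
    by rewrite /tweight (negPf ne_vw) eqxx ltnNge ltnW.
  have sX : #|swap_set v w X| = size A by rewrite card_swap_set.
  have sY : #|swap_set v w Y| = size B by rewrite card_swap_set.
  have D1XY := D1E A B X Y szX szY.
  move: vU wU; rewrite -XU -YC !inE => vU wU.
  split=> [vX wX|vX wX|vwX]; rewrite /= /t /XY /XY'.
  - have [vY wY] : v \notin Y /\ w \in Y.
      by move: vU wU vX wX; do !case: (_ \in _).
    rewrite D1XY /dminor vX wX (negPf vY) /= mulr0 scaler0 addr0 D2E //.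
    rewrite /dminor /set_weight !inE tpermR tpermL vX (negPf wX) (negPf vY) wY /=.
    rewrite swap_setC swap_setK [swap_set w v Y]swap_setC tw2 mulr1.
    by rewrite scalerDr scalerA mulVr // scale1r addrAC subrr add0r.
  - have [vY wY] : v \in Y /\ w \notin Y.
      by move: vU wU vX wX; do !case: (_ \in _).
    rewrite D1XY /dminor (negPf vX) vY wY /= mul0r add0r /set_weight (negPf vX) wX.
    rewrite tw1 mul1r linearZ /= D2E // /dminor /set_weight.
    rewrite !inE tpermR tpermL vY wX (negPf vX) /= tw2 mulr1 (negPf wY) /=.
    rewrite [swap_set w v (swap_set _ _ _)]swap_setC swap_setK.
    rewrite [swap_set w v X]swap_setC scalerA mulVr // scale1r.
    by rewrite -addrA -scalerBl -[in RHS]scaleNr opprB.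
  - have dX : dminor v w A X = 0 by rewrite /dminor vwX andbN.
    have dY : dminor v w B Y = 0.
      suff e : (v \in Y) = (w \in Y) by rewrite /dminor e andbN.
      by move: vU wU vwX; do !case: (_ \in _).
    by rewrite D1XY dX dY mul0r mulr0 scaler0 addr0 linear0 scaler0 sub0r scaleNr.
(* Otherwise the column [u] just before [w] is exchanged with [w], and the induction hypothesis is
   used for [v] and [u]. *)
have lt_u : (w.-1 < n)%N by have := ltn_ord w; lia.
pose u := Ordinal lt_u.
have vu : (v < u)%N by rewrite /=; move: nvw; lia.
have uw : (u < w)%N by rewrite /=; lia.
have adj : adjacent u w by rewrite /adjacent /=; apply/orP; left; lia.
have adj' : adjacent w u by rewrite adjacent_sym.
have ne_vu : v != u by apply: contraTneq vu => ->; rewrite ltnn.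
have ne_vw : v != w by apply: contraTneq lt_vw => ->; rewrite ltnn.
have ne_uw : u != w by apply: contraTneq uw => ->; rewrite ltnn.
(* Being between [v] and [w], the column [u] is in [C] or outside [U]: it occurs twice or not at
   all, while [w] occurs once. So [exists_swap] applies in one of its two directions. *)
have [D1 D1E] : exists D : {linear R -> R}, forall A B X Y,
    #|X| = size A -> #|Y| = size B -> X :|: Y = U -> X :&: Y = C ->
    D (sminor A X * sminor B Y) =
      sminor A (swap_set u w X) * sminor B (swap_set u w Y).
  case uU: (u \in U).
    have uC : u \in C by apply: btw; rewrite ?uU // vu uw.
    have [D DE] := exists_swap adj; exists D => A B X Y szX szY XU YC.
    apply: DE => //; move: uC wU; rewrite -XU -YC !inE.
    by do !case: (_ \in _).
  have [D DE] := exists_swap adj'; exists D => A B X Y szX szY XU YC.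
  rewrite ![swap_set u w _]swap_setC; apply: DE => //.
  by move: uU wU; rewrite -XU -YC !inE; do !case: (_ \in _).
(* The way back: the multiplicities of [u] and [w] are now exchanged, hence so is the direction. *)
have [D2 D2E] : exists D : {linear R -> R}, forall A B X Y,
    #|X| = size A -> #|Y| = size B ->
    X :|: Y = swap_set u w U -> X :&: Y = swap_set u w C ->
    D (sminor A X * sminor B Y) =
      sminor A (swap_set u w X) * sminor B (swap_set u w Y).
  case uU: (u \in U).
    have uC : u \in C by apply: btw; rewrite ?uU // vu uw.
    have [D DE] := exists_swap adj'; exists D => A B X Y szX szY XU YC.
    rewrite ![swap_set u w _]swap_setC; apply: DE => //.
    move/setP: XU => XU; move/setP: YC => YC.
    move: (XU u) (XU w) (YC u) (YC w) uC wU uU; rewrite !inE tpermL tpermR.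
    by do 8!case: (_ \in _).
  have [D DE] := exists_swap adj; exists D => A B X Y szX szY XU YC.
  apply: DE => //; move/setP: XU => XU; move/setP: YC => YC.
  move: (XU u) (XU w) (YC u) (YC w) wU uU; rewrite !inE tpermL tpermR.
  by do 8!case: (_ \in _).
pose U' := swap_set u w U; pose C' := swap_set u w C.
have vw_id : tperm u w v = v by rewrite tpermD // eq_sym.
have vU' : v \in U' :\: C' by rewrite !inE vw_id -in_setD.
have uU' : u \in U' :\: C' by rewrite !inE tpermL -in_setD.
have [|||||T' T'E] := IHd u U' C' => //.
- by move: le_d uw; rewrite /=; clear; lia.
- move=> z /andP [vz zu]; rewrite !inE tpermD; first 1 last.
  + by apply: contraTneq zu => <-; rewrite ltnn.
  + by apply: contraTneq zu => <-; rewrite -leqNgt ltnW.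
  by apply: btw; rewrite vz (ltn_trans zu).
(* Since (v u) fixes [U'] and [C'], [D2] can be evaluated on both products in the value of [T'];
   [swap_set_conj] then turns (v u) into (v w). *)
exists (D2 \o T' \o D1) => A B X Y szX szY XU YC XY XY' /=.
have sX : #|swap_set u w X| = size A by rewrite card_swap_set.
have sY : #|swap_set u w Y| = size B by rewrite card_swap_set.
have XU1 : swap_set u w X :|: swap_set u w Y = U' by rewrite -swap_setU XU.
have YC1 : swap_set u w X :&: swap_set u w Y = C' by rewrite -swap_setI YC.
have := T'E A B _ _ sX sY XU1 YC1; rewrite /= !inE vw_id tpermL.
have D2a : D2 (sminor A (swap_set u w X) * sminor B (swap_set u w Y)) = XY.
  by rewrite D2E // !swap_setK.
have D2b : D2 (sminor A (swap_set v u (swap_set u w X)) *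
               sminor B (swap_set v u (swap_set u w Y))) = XY'.
  rewrite D2E ?card_swap_set // ?swap_set_conj //.
    rewrite -swap_setU XU1 swap_set_id //.
    by move: vU' uU'; rewrite !inE => /andP [_ ->] /andP [_ ->].
  rewrite -swap_setI YC1 swap_set_id //.
  by move: vU' uU'; rewrite !inE => /andP [/negPf -> _] /andP [/negPf -> _].
have D1XY : D1 XY = sminor A (swap_set u w X) * sminor B (swap_set u w Y).
  exact: D1E.
case=> h1 h2 h3; split=> [vX wX|vX wX|vwX]; rewrite D1XY.
- by rewrite h1.
- by rewrite h2 // linearB linearZ /= D2a D2b.
- by rewrite h3 // linearZ /= D2a.
Qed.

End SetMinors.

(** * q-commutation at the top of the tower *)

Lemma ord_succ_closed n (P : pred 'I_n) :
  (forall j j' : 'I_n, j' = j.+1 :> nat -> P j -> P j') ->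
  forall i j : 'I_n, (i <= j)%N -> P i -> P j.
Proof.
move=> step i j; move: {2}(j - i)%N (leqnn (j - i)%N) => d.
elim: d j => [|d IHd] j le_d le_ij Pi.
  by have <- : i = j by apply: val_inj => /=; lia.
case: (ltngtP i j) => [lt_ij|?|/val_inj <- //]; last by lia.
have lt_j : (j.-1 < n)%N by have := ltn_ord j; lia.
apply: (step (Ordinal lt_j)); first by rewrite /=; lia.
by apply: IHd => //=; lia.
Qed.

Section Configurations.
Variable n : nat.
Implicit Types (I J : {set 'I_n}).

(* A column carries one of four labels, according to its membership in I and
   J.  The measure decreases when a column of J only moves left, when a column
   of I only moves right, and when a column in both and one in none are traded
   for one of J only and one of I only. *)
Definition label_cost I J (v : 'I_n) : nat :=
  match v \in I, v \in J with
  | true, false => n.-1 - v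
  | false, true => v
  | _, _ => n
  end.

Definition config_cost I J := (\sum_v label_cost I J v)%N.

Definition separated I J :=
  forall u v : 'I_n, u \in I :\: J -> v \in J :\: I -> (v < u)%N.

Lemma config_cost_lt I J I1 J1 (j j' : 'I_n) : j' = j.+1 :> nat ->
  (forall v, v != j -> v != j' -> (v \in I1) = (v \in I) /\ (v \in J1) = (v \in J)) ->
  (label_cost I1 J1 j + label_cost I1 J1 j' < label_cost I J j + label_cost I J j')%N ->
  (config_cost I1 J1 < config_cost I J)%N.
Proof.
move=> jj same lt; have ne_j : j' != j by rewrite -val_eqE /= jj gtn_eqF.
have split_cost I2 J2 : config_cost I2 J2 = (label_cost I2 J2 j +
    label_cost I2 J2 j' + \sum_(v | (v != j) && (v != j')) label_cost I2 J2 v)%N.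
  by rewrite /config_cost (bigD1 j) //= (bigD1 j') //= addnA.
rewrite !split_cost (eq_bigr (label_cost I J)) ?ltn_add2r // => v /andP [vj vj'].
by rewrite /label_cost; have [-> ->] := same v vj vj'.
Qed.

(** Call a column neutral if it is in both sets or in none. Here a neutral column stands left of a
    J-only one or right of an I-only one; the multiplicities differ by one, so [exists_swap] can
    exchange the two columns. *)
Definition swappable I J (j j' : 'I_n) :=
  ((j \in I) == (j \in J)) && (j' \in J) && (j' \notin I)
  || (j \in I) && (j \notin J) && ((j' \in I) == (j' \in J)).

Lemma in_swap_setD (j j' v : 'I_n) I :
  v != j -> v != j' -> (v \in swap_set j j' I) = (v \in I).
Proof. by move=> vj vj'; rewrite inE tpermD // eq_sym. Qed.

Lemma swappable_cost I J (j j' : 'I_n) : j' = j.+1 :> nat -> swappable I J j j' ->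
  (config_cost (swap_set j j' I) (swap_set j j' J) < config_cost I J)%N.
Proof.
move=> jj sw; apply: (config_cost_lt jj) => [v vj vj'|].
  by rewrite !in_swap_setD.
have lt_j := ltn_ord j; have lt_j' := ltn_ord j'.
rewrite /label_cost !inE tpermL tpermR; move: sw; rewrite /swappable.
by case: (j \in I); case: (j \in J); case: (j' \in I); case: (j' \in J) => //= _; move: jj lt_j lt_j'; clear; lia.
Qed.

Lemma swappable_separated I J (j j' : 'I_n) :
  j' = j.+1 :> nat -> swappable I J j j' -> separated I J ->
  separated (swap_set j j' I) (swap_set j j' J).
Proof.
move=> jj sw sep u v; have := sep (tperm j j' u) (tperm j j' v).
rewrite !in_setD !inE => + uI vI; rewrite uI vI => /(_ isT isT).
move: uI vI sw; rewrite /swappable.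
have neq (y z : 'I_n) : y <> z -> nat_of_ord y <> z by move=> yz /val_inj.
case: (tpermP j j' u) => [->|->|/neq uj /neq uj'];
  case: (tpermP j j' v) => [->|->|/neq vj /neq vj'];
  try (by move=> /andP [/negPf -> ->] /andP [/negPf -> ->]);
  by move=> _ _ _; lia.
Qed.

(** The right neighbour of an I-only column is not neutral, as no swap is left, nor J-only, by
    separation; the argument for J-only columns is symmetric. *)
Lemma unswappable_closed I J : separated I J ->
  (forall j j' : 'I_n, j' = j.+1 :> nat -> ~~ swappable I J j j') ->
  (forall i j : 'I_n, (i <= j)%N -> i \in I :\: J -> j \in I :\: J) /\
  (forall i j : 'I_n, (i <= j)%N -> j \in J :\: I -> i \in J :\: I).
Proof.
move=> sep nsw.
have nIJ (j j' : 'I_n) : j' = j.+1 :> nat -> j \in I :\: J -> j' \in J :\: I -> False.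
  by move=> jj jI j'J; have := sep j j' jI j'J; rewrite jj ltnNge leqnSn.
split=> [i j le_ij iIJ|i j le_ij jJI].
  apply: (@ord_succ_closed n (mem (I :\: J)) _ i j) => // j0 j1 jj j0I.
  move: (nsw _ _ jj) (nIJ _ _ jj j0I) (j0I); rewrite /swappable !inE.
  by case: (j0 \in I); case: (j0 \in J); case: (j1 \in I); case: (j1 \in J) => //= _ h; case: h.
apply: contraTT jJI => iJI.
apply: (@ord_succ_closed n (fun v => v \notin J :\: I) _ i j) => // j0 j1 jj.
apply: contraNN => j1J; move: (nsw _ _ jj) (nIJ _ _ jj) j1J; rewrite /swappable !inE.
by case: (j0 \in I); case: (j0 \in J); case: (j1 \in I); case: (j1 \in J) => //= _ h; case: h.
Qed.

End Configurations.

(** * Proof of the q-commutation *)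

Section QCommutation.
Variables (K : comUnitRingType) (q : K) (n : nat) (R : algType K).
Variable x : 'I_n -> 'I_n -> R.
Hypothesis q_unit : q \is a GRing.unit.
Hypothesis transvection : forall a b : 'I_n, adjacent a b ->
  exists Phi : {rmorphism R -> 'M[R]_2},
  (forall i c, Phi (x i c) = transv_mx q x a b (i, c)) /\
  (forall c y i j, Phi (c *: y) i j = c *: Phi y i j).
Hypothesis x_comm : forall i j i' j' : 'I_n, (i < i')%N -> (j' < j)%N ->
  x i j * x i' j' = x i' j' * x i j.
Variables A B : seq 'I_n.
Hypothesis lt_AB : forall i i', i \in A -> i' \in B -> (i < i')%N.
Implicit Types (I J : {set 'I_n}).
Local Notation sminor := (sminor q x).

(** Rows of [A] are above those of [B] and columns of [I] are right of those of [J], so each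
    generator of one minor commutes with each generator of the other. *)
Lemma sminor_comm I J : #|I| = size A -> #|J| = size B ->
  (forall i j, i \in I -> j \in J -> (j < i)%N) ->
  sminor B J * sminor A I = sminor A I * sminor B J.
Proof.
move=> szI szJ lt_JI; apply/esym; rewrite /sminor /minor.
have mem_nth_enum (X : {set 'I_n}) C (i0 : 'I_n) (i : 'I_(size C)) :
    #|X| = size C -> nth i0 (enum X) i \in X.
  by move=> szX; rewrite -mem_enum mem_nth // -cardE szX.
apply: commr_sum => tau _; rewrite /GRing.comm -scalerAr -scalerAl; congr (_ *: _).
apply/esym; apply: commr_sum => sigma _.
rewrite /GRing.comm -scalerAr -scalerAl; congr (_ *: _); apply/esym.
apply: commr_prod => i _; apply/esym; apply: commr_prod => j _; apply/esym.
apply: x_comm; first by apply: lt_AB; exact: mem_tnth.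
by apply: lt_JI; exact: mem_nth_enum.
Qed.

Let qrel I J :=
  sminor B J * sminor A I = q ^+ #|I :&: J| *: (sminor A I * sminor B J).

(** The multiplicity condition ignores the order of the factors, so one D exchanges the columns on
    both sides of the relation. *)
Let qrel_swap (a b : 'I_n) I J : adjacent a b -> #|I| = size A -> #|J| = size B ->
  ((a \in I) + (a \in J) = ((b \in I) + (b \in J)).+1)%N ->
  qrel I J -> qrel (swap_set a b I) (swap_set a b J).
Proof.
move=> adj szI szJ wt; have [D DE] := exists_swap q_unit transvection adj.
move/(congr1 D); rewrite linearZ /= !DE // 1?[in LHS]addnC 1?[in RHS]addnC //.
by rewrite /qrel -swap_setI card_swap_set.
Qed.

(** Induction on [config_cost]: swap neighbours while possible, then trade an adjacent pair of a
    column in both sets and a column in none. When neither move exists, the cardinality condition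
    forces [I] and [J] to be disjoint, and [sminor_comm] concludes. *)
Lemma sminor_qcomm I J : #|I| = size A -> #|J| = size B ->
  (#|I| + #|J|)%N = n -> separated I J ->
  sminor B J * sminor A I = q ^+ #|I :&: J| *: (sminor A I * sminor B J).
Proof.
rewrite -/(qrel I J).
have [m] := ubnP (config_cost I J); elim: m I J => // m IHm I J.
rewrite ltnS => le_m szI szJ szn sep.
have adjE (j j' : 'I_n) : j' = j.+1 :> nat -> adjacent j j'.
  by move=> jj; rewrite /adjacent jj eqxx.
case: (pickP (fun u : 'I_n * 'I_n => (u.2 == u.1.+1 :> nat) && swappable I J u.1 u.2))
  => [[j j'] /andP [/eqP /= jj sw]|nsw].
  have rel1 : qrel (swap_set j j' I) (swap_set j j' J).
    apply: IHm; rewrite ?card_swap_set //; last exact: swappable_separated.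
    exact: leq_trans (swappable_cost jj sw) le_m.
  have adj := adjE _ _ jj; rewrite -[I](swap_setK j j') -[J](swap_setK j j').
  have [wt|wt] : ((j \in I) + (j \in J) = ((j' \in I) + (j' \in J)).+1)%N \/
                 ((j' \in I) + (j' \in J) = ((j \in I) + (j \in J)).+1)%N.
    move: sw; rewrite /swappable.
    by case: (j \in I); case: (j \in J); case: (j' \in I); case: (j' \in J) => //= _; by [left|right].
  - rewrite ![swap_set j j' (swap_set _ _ _)]swap_setC.
    apply: qrel_swap; rewrite ?card_swap_set //; first by rewrite adjacent_sym.
    by rewrite !inE tpermL tpermR.
  - by apply: qrel_swap; rewrite ?card_swap_set // !inE tpermL tpermR.
have {}nsw (j j' : 'I_n) : j' = j.+1 :> nat -> ~~ swappable I J j j'.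
  by move=> jj; have := nsw (j, j'); rewrite /= jj eqxx /= => ->.
have [upI downJ] := unswappable_closed sep nsw.
case: (pickP (fun u : 'I_n * 'I_n => [&& u.2 == u.1.+1 :> nat, u.1 \in I, u.1 \in J,
    u.2 \notin I & u.2 \notin J])) => [[j j'] /and5P /= [/eqP jj jI jJ j'I j'J]|n20].
  have adj := adjE _ _ jj; have ne_j := adjacent_neq adj.
  pose I1 := swap_set j j' I.
  have cardIJ : #|I :&: J| = #|I1 :&: J|.+1.
    have jIJ : j \in I :&: J by rewrite inE jI.
    rewrite (cardsD1 j (I :&: J)) jIJ add1n; congr _.+1; apply: eq_card => v; rewrite !inE.
    case: tpermP => [->|->|/eqP vj _].
    - by rewrite eqxx (negPf j'I).
    - by rewrite (negPf j'J) !andbF.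
    - by rewrite vj.
  have rel1 : qrel I1 J.
    apply: IHm; rewrite ?card_swap_set //.
      apply: leq_trans le_m; apply: (config_cost_lt jj) => [v vj vj'|].
        by rewrite in_swap_setD.
      rewrite /label_cost !inE tpermL tpermR jI jJ (negPf j'I) (negPf j'J).
      by move: jj (ltn_ord j'); clear; lia.
    (* Separation persists: [j'] is outside the initial segment of J-only columns, and [j] is
       outside the final segment of I-only ones. *)
    move=> u v; rewrite !inE => /andP [uJ]; case: tpermP => [_|->|_ _] uI /andP [vI vJ].
    - by rewrite (negPf j'I) in uI.
    - rewrite ltnNge; apply/negP => le_v; have := downJ _ _ le_v.
      move: vI; case: tpermP => [vj|->|_ _] vI.
      + by move: le_v; rewrite vj jj ltnn.
      + by rewrite jI in vI.
      + by rewrite !inE vI vJ (negPf j'J) => /(_ isT) /andP [].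
    - move: vI; case: tpermP => [vj|->|_ _] vI.
      + rewrite vj ltnNge; apply/negP => le_u; have := upI _ _ le_u.
        by rewrite !inE uJ uI jJ => /(_ isT).
      + by rewrite jI in vI.
      + by apply: sep; rewrite !inE ?uJ ?vI.
  have adj' : adjacent j' j by rewrite adjacent_sym.
  (* D turns [j'] into [j], which affects [I1] alone. In the product with [J] first, it passes a
     minor containing [j], of weight q^-1; this yields the additional factor q. *)
  have [D DE] := exists_derivation q_unit transvection adj'.
  move: rel1 => /(congr1 D); rewrite linearZ /= !DE ?card_swap_set //.
  rewrite /dminor /set_weight !inE tpermL tpermR (negPf j'J) jI jJ (negPf j'I) /=.
  rewrite !mul0r !mulr0 mul1r scaler0 addr0 add0r swap_setC swap_setK.
  rewrite /tweight (negPf ne_j) eqxx ltnNge ltnW ?jj //= => e.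
  rewrite /qrel cardIJ exprS -scalerA -[X in _ = q *: X]e scalerA mulrV //.
  by rewrite scale1r.
case: (pickP (fun u : 'I_n * 'I_n => [&& u.2 == u.1.+1 :> nat, u.1 \notin I, u.1 \notin J,
    u.2 \in I & u.2 \in J])) => [[j j'] /and5P /= [/eqP jj jI jJ j'I j'J]|n02].
  have adj := adjE _ _ jj; have ne_j := adjacent_neq adj.
  pose J1 := swap_set j j' J.
  have cardIJ : #|I :&: J| = #|I :&: J1|.+1.
    have jIJ : j' \in I :&: J by rewrite inE j'I.
    rewrite (cardsD1 j' (I :&: J)) jIJ add1n; congr _.+1; apply: eq_card => v; rewrite !inE.
    case: tpermP => [->|->|_ /eqP vj].
    - by rewrite (negPf jI) !andbF.
    - by rewrite eqxx (negPf jJ) andbF.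
    - by rewrite vj.
  have rel1 : qrel I J1.
    apply: IHm; rewrite ?card_swap_set //.
      apply: leq_trans le_m; apply: (config_cost_lt jj) => [v vj vj'|].
        by rewrite in_swap_setD.
      rewrite /label_cost !inE tpermL tpermR j'I j'J (negPf jI) (negPf jJ).
      by move: jj (ltn_ord j'); clear; lia.
    move=> u v; rewrite !inE => /andP [uJ uI] /andP [vI].
    case: tpermP => [->|->|_ _] vJ.
    - rewrite ltnNge; apply/negP => le_u; have := upI _ _ le_u.
      move: uJ; case: tpermP => [->|uj|_ _] uJ.
      + by rewrite j'J in uJ.
      + by move: le_u; rewrite uj jj ltnn.
      + by rewrite !inE uJ uI (negPf jI) andbF => /(_ isT).
    - by rewrite (negPf jJ) in vJ.
    - move: uJ; case: tpermP => [uj|uj|_ _] uJ.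
      + by rewrite j'J in uJ.
      + rewrite uj ltnNge; apply/negP => le_v; have := downJ _ _ le_v.
        by rewrite !inE vI vJ j'I => /(_ isT).
      + by apply: sep; rewrite !inE ?uJ ?vI.
  (* Here D turns [j] into [j'] and affects [J1] alone; in the product with [I] first, it passes a
     minor containing [j'], of weight q. *)
  have [D DE] := exists_derivation q_unit transvection adj.
  move: rel1 => /(congr1 D); rewrite linearZ /= !DE ?card_swap_set //.
  rewrite /dminor /set_weight !inE tpermL tpermR (negPf jJ) j'I j'J (negPf jI) /=.
  rewrite !mul0r !mulr0 mul1r scaler0 addr0 add0r swap_setK.
  rewrite /tweight eq_sym (negPf ne_j) eqxx jj ltnSn => e.
  by rewrite /qrel cardIJ exprSr -scalerA.
(* The right neighbour of a column in both sets is neither J-only, by [nsw], nor in none, by [n20];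
   I-only columns are covered by [upI]. *)
have upI' (i j : 'I_n) : (i <= j)%N -> i \in I -> j \in I.
  apply: (@ord_succ_closed n (mem I)) => j0 j1 jj j0I.
  have := upI j0 j1; rewrite jj leqnSn => /(_ isT).
  move: (nsw _ _ jj) (n20 (j0, j1)) j0I; rewrite /= jj eqxx /swappable !inE.
  by case: (j0 \in I); case: (j0 \in J); case: (j1 \in I); case: (j1 \in J) => //= _ _ _ h; have := h isT.
have downJ' (i j : 'I_n) : (i <= j)%N -> j \in J -> i \in J.
  move=> le_ij; apply: contraTT; move: i j le_ij.
  apply: (@ord_succ_closed n (fun v => v \notin J)) => j0 j1 jj.
  apply: contraNN => j1J.
  have := downJ j0 j1; rewrite jj leqnSn => /(_ isT).
  move: (nsw _ _ jj) (n02 (j0, j1)) j1J; rewrite /= jj eqxx /swappable !inE.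
  by case: (j0 \in I); case: (j0 \in J); case: (j1 \in I); case: (j1 \in J) => //= _ _ _ h; have := h isT.
have IJ0 : I :&: J = set0.
  apply/eqP; rewrite -cards_eq0; apply/negP => IJn0.
  have [c] : exists c, c \in I :&: J by apply/card_gt0P; rewrite lt0n; exact/negP.
  rewrite inE => /andP [cI cJ].
  (* A common column would make [I] and [J] cover everything, so that their cardinalities would add
     up to more than n. *)
  have UT : I :|: J = [set: 'I_n].
    apply/setP=> v; rewrite !inE; case: (leqP c v) => [le_cv|/ltnW le_vc].
      by rewrite (upI' c).
    by rewrite (downJ' v c) ?orbT.
  have := cardsUI I J; rewrite UT cardsT card_ord szn => /eqP.
  by rewrite -[X in _ == X]addn0 eqn_add2l => /IJn0.
rewrite /qrel IJ0 cards0 expr0 scale1r; apply: sminor_comm => // i j iI jJ.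
rewrite ltnNge; apply/negP => le_ij.
have iJ := downJ' _ _ le_ij jJ; have := in_set0 i.
by rewrite -IJ0 inE iI iJ.
Qed.

End QCommutation.

(** * Climbing the standard tower *)

(** Serves to recognise a successor-closed part of [V] as [top_col]. *)
Lemma filter_drop (T : eqType) (P : pred T) (s : seq T) :
  (forall x0 i j, (i <= j < size s)%N -> P (nth x0 s i) -> P (nth x0 s j)) ->
  filter P s = drop (size s - size (filter P s)) s.
Proof.
elim: s => //= c s IHs up.
case: ifP => Pc.
  have -> : filter P s = s.
    apply/all_filterP/(all_nthP c) => i lt_i.
    by have := up c 0%N i.+1; rewrite /= ltnS; apply.
  by rewrite /= subnn drop0.
have le_s : (size (filter P s) <= size s)%N by rewrite size_filter count_size.
rewrite subSn //= -IHs // => x0 i j lt_j; exact: (up x0 i.+1 j.+1).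
Qed.

Lemma index_map_in (T U : eqType) (f : T -> U) (s : seq T) x :
  {in s &, injective f} -> x \in s -> index (f x) (map f s) = index x s.
Proof.
elim: s => //= c s IHs inj xs; case: (eqVneq c x) => [->|cx]; first by rewrite eqxx.
have xs' : x \in s by move: xs; rewrite inE eq_sym (negPf cx).
case: eqP => [/inj e|_].
  by rewrite e ?mem_head ?eqxx // in cx.
by rewrite IHs // => y z ys zs; apply: inj; rewrite inE ?ys ?zs orbT.
Qed.

(** * The standard transposition exchanges consecutive elements *)

Section StandardSteps.
Variables (n : nat) (V : seq 'I_n).
Hypothesis inc_V : increasing V.
Implicit Types (B : seq 'I_n) (u v w : 'I_n).
Local Notation rank := (rank V).

Let trans : transitive (relpre (val : 'I_n -> nat) ltn).
Proof. by move=> ? ? ?; exact: ltn_trans. Qed.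

Lemma increasing_uniq B : increasing B -> uniq B.
Proof.
rewrite /increasing sorted_map; apply: sorted_uniq => [|i]; first exact: trans.
exact: ltnn.
Qed.

Let uV : uniq V. Proof. exact: increasing_uniq. Qed.

Lemma rank_inj : {in V &, injective rank}.
Proof. by move=> u v uV' vV [] /index_inj; apply=> //; exact: u. Qed.

Lemma rank_ltn u v : u \in V -> v \in V -> (rank u < rank v)%N = (u < v)%N.
Proof.
have lt_index : {in V &, forall y z : 'I_n, (index y V < index z V)%N -> (y < z)%N}.
  by move: inc_V; rewrite /increasing sorted_map; exact: sorted_ltn_index.
move=> uV' vV; rewrite ltnS; apply/idP/idP => [|lt_uv]; first exact: lt_index.
case: ltngtP => // [/lt_index|/index_inj] e.
  by have := e vV uV'; rewrite ltnNge ltnW.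
by move: lt_uv; rewrite e ?ltnn //; exact: u.
Qed.

Lemma rank_le_size u : u \in V -> (rank u <= size V)%N.
Proof. by rewrite index_mem. Qed.

Lemma increasing_filter (P : pred 'I_n) B : increasing B -> increasing (filter P B).
Proof. by rewrite /increasing !sorted_map; apply: sorted_filter; exact: trans. Qed.

(** Otherwise [B] would be closed under successor in [V], hence a final segment. Ranks start at 1
    and positions at 0, so [nth v V (rank v)] is the successor of [v]. *)
Lemma exists_gap B : increasing B -> {subset B <= V} -> B != top_col V (size B) ->
  exists v, [/\ v \in B, (rank v < size V)%N & nth v V (rank v) \notin B].
Proof.
move=> inc_B sBV neB.
suff /hasP [v vB /andP [lt_v nB]] :
    has (fun v => (rank v < size V)%N && (nth v V (rank v) \notin B)) B.
  by exists v.
apply: contraNT neB => /hasPn closed; apply/eqP.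
have eB : B = filter (mem B) V.
  apply: increasing_eq => //; first exact: increasing_filter.
  by move=> v; rewrite mem_filter /=; case vB: (v \in B); rewrite //= sBV.
have sizeB : size B = size (filter (mem B) V) by rewrite -eB.
rewrite {1}eB /top_col sizeB; apply: filter_drop => x0 i j /andP [le_ij lt_j] iB.
elim: j le_ij lt_j => [|j IHj]; first by rewrite leqn0 => /eqP <-.
rewrite leq_eqVlt => /orP [/eqP <- //|]; rewrite ltnS => le_ij lt_j.
have jB := IHj le_ij (ltnW lt_j).
have rk : rank (nth x0 V j) = j.+1 by rewrite /Defs.rank index_uniq // ltnW.
have := closed _ jB; rewrite rk lt_j negbK /=.
by rewrite (set_nth_default x0).
Qed.

Lemma col_entry_nth x0 B a : (a < size B)%N -> col_entry V B a = rank (nth x0 B a).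
Proof. by move=> lt_a; rewrite /col_entry (nth_map x0). Qed.

Lemma col_entry_size B : col_entry V B (size B) = (size V).+1.
Proof. by rewrite /col_entry nth_default // size_map. Qed.

Lemma index_ltn B u v : increasing B -> u \in B -> v \in B ->
  (index u B < index v B)%N = (u < v)%N.
Proof.
move=> inc_B; have uB := increasing_uniq inc_B.
have lt_index : {in B &, forall y z : 'I_n, (index y B < index z B)%N -> (y < z)%N}.
  by move: inc_B; rewrite /increasing sorted_map; exact: sorted_ltn_index.
move=> uB' vB; apply/idP/idP => [|lt_uv]; first exact: lt_index.
case: ltngtP => // [/lt_index|/index_inj] e.
  by have := e vB uB'; rewrite ltnNge ltnW.
by move: lt_uv; rewrite e ?ltnn //; exact: u.
Qed.

Lemma std_z_spec B : increasing B -> {subset B <= V} -> B != top_col V (size B) ->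
  exists v w, [/\ v \in B, w \in V, w \notin B, std_z V B = rank v
                & rank w = (rank v).+1].
Proof.
move=> inc_B sBV neB; have [v0 [v0B lt_v0 nv0]] := exists_gap inc_B sBV neB.
have x0 := v0; pose gap a := (1 < col_entry V B a.+1 - col_entry V B a)%N.
have lt_e y z : y \in B -> z \in B -> (y < z)%N -> (rank y < rank z)%N.
  by move=> yB zB; rewrite rank_ltn ?sBV.
have gap0 : gap (index v0 B).
  have lt_i0 : (index v0 B < size B)%N by rewrite index_mem.
  rewrite /gap (col_entry_nth x0 lt_i0) nth_index //.
  (* At the last position the next entry is the default value m + 1, and the gap says that [v0] is
     not the last element of [V]. *)
  have : (index v0 B < size B)%N by rewrite index_mem.
  rewrite leq_eqVlt => /orP [/eqP ->|lt1].
    by rewrite col_entry_size ltn_subRL addn1 ltnS.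
  rewrite (col_entry_nth x0) //; set v1 := nth x0 B _.
  have v1B : v1 \in B by rewrite mem_nth.
  have lt01 : (rank v0 < rank v1)%N.
    apply: lt_e => //; rewrite -(index_ltn inc_B) // /v1 index_uniq //.
    exact: increasing_uniq.
  rewrite ltn_subRL addn1 ltn_neqAle lt01 andbT; apply: contraNneq nv0 => e.
  suff -> : nth v0 V (rank v0) = v1 by [].
  by move: e; rewrite {2}/Defs.rank => -[->]; rewrite nth_index // sBV.
(* The maximum over gap positions is attained, because [v0] provides one. *)
have [a ga ea] : exists2 a : 'I_(size B), gap a & std_pos V B = a.
  have lt0 : (index v0 B < size B)%N by rewrite index_mem.
  have /(eq_bigmax_cond (fun a : 'I_(size B) => a : nat)) [a ga ea] :
      (0 < #|[pred a : 'I_(size B) | gap a]|)%N.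
    by apply/card_gt0P; exists (Ordinal lt0).
  by exists a.
have lt_a := ltn_ord a; set v := nth x0 B a; have vB : v \in B by rewrite mem_nth.
have sz : std_z V B = rank v by rewrite /std_z ea (col_entry_nth x0).
have lt_v : (rank v < size V)%N.
  move: ga; rewrite /gap (col_entry_nth x0 lt_a) -/v.
  move: lt_a; rewrite leq_eqVlt => /orP [/eqP ->|lt1].
    by rewrite col_entry_size ltn_subRL addn1 ltnS.
  rewrite (col_entry_nth x0) // ltn_subRL addn1 => lt2.
  by apply: leq_trans (ltnW lt2) _; rewrite rank_le_size // sBV // mem_nth.
pose w := nth x0 V (rank v); have wV : w \in V by rewrite mem_nth.
have rw : rank w = (rank v).+1 by rewrite {1}/Defs.rank index_uniq.
exists v, w; split=> //; apply/negP => wB.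
(* If [w] were in [B], the entry following [v] would be at most [w], against the gap. *)
have lt_aw : (a < index w B)%N.
  rewrite -[X in (X < _)%N](index_uniq x0 lt_a) ?increasing_uniq // -/v.
  by rewrite index_ltn // -rank_ltn ?sBV // rw.
have lt_a1 : (a.+1 < size B)%N by apply: leq_ltn_trans lt_aw _; rewrite index_mem.
move: ga; rewrite /gap (col_entry_nth x0 lt_a) (col_entry_nth x0 lt_a1) -/v.
rewrite ltn_subRL addn1 -rw; set v1 := nth x0 B a.+1.
have v1B : v1 \in B by rewrite mem_nth.
rewrite rank_ltn ?sBV // -(index_ltn inc_B) // /v1 index_uniq ?increasing_uniq //.
by rewrite ltnNge lt_aw.
Qed.

Lemma adj_transpE v w u : v \in V -> w \in V -> rank w = (rank v).+1 -> u \in V ->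
  adj_transp V (rank v) u = tperm v w u.
Proof.
move=> vV wV rw uV'; rewrite /adj_transp -rw.
case: eqP => [/rank_inj -> //|nuv].
  by rewrite tpermL; move: rw => [] <-; rewrite nth_index.
case: eqP => [/rank_inj -> //|nuw]; first by rewrite tpermR nth_index.
by rewrite tpermD //; apply/eqP => e; [apply: nuv|apply: nuw]; rewrite e.
Qed.

Lemma rank_succ_between v w u : v \in V -> w \in V -> rank w = (rank v).+1 ->
  u \in V -> ~~ (v < u < w)%N.
Proof.
move=> vV wV rw uV'; rewrite -(rank_ltn vV uV') -(rank_ltn uV' wV) rw ltnS.
by rewrite [(_ <= rank v)%N]leqNgt andbN.
Qed.

End StandardSteps.

(** * Effect of a consecutive transposition on tuples *)

Section TowerCombinatorics.
Variables (n : nat) (V : seq 'I_n).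
Hypothesis inc_V : increasing V.
Implicit Types (B u : seq 'I_n) (v w : 'I_n).
Local Notation rank := (rank V).

Definition consecutive v w := [&& v \in V, w \in V & rank w == (rank v).+1].

Variables v w : 'I_n.
Hypothesis vw : consecutive v w.
Let vV : v \in V. Proof. by case/and3P: vw. Qed.
Let wV : w \in V. Proof. by case/and3P: vw. Qed.
Let rw : rank w = (rank v).+1. Proof. by case/and3P: vw => _ _ /eqP. Qed.

Lemma consecutive_ltn : (v < w)%N.
Proof. by rewrite -(rank_ltn inc_V) // rw. Qed.

Lemma consecutive_between c : c \in V -> ~~ (v < c < w)%N.
Proof. exact: rank_succ_between. Qed.

Let lt_vw := consecutive_ltn.

Lemma tperm_closed c : (tperm v w c \in V) = (c \in V).
Proof. by case: tpermP => [->|->|//]; rewrite vV wV. Qed.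

Lemma mem_map_tperm u c : (c \in map (tperm v w) u) = (tperm v w c \in u).
Proof. by rewrite -{1}(tpermK v w c) mem_map //; exact: perm_inj. Qed.

Lemma map_val_tperm u :
  map val (map (tperm v w) u) = map (swap_nat v w) (map val u).
Proof.
rewrite -!map_comp; apply: eq_map => c /=; rewrite /swap_nat.
case: tpermP => [->|->|/eqP nv /eqP nw]; first by rewrite eqxx.
  by rewrite gtn_eqF // eqxx.
by rewrite -!val_eqE /= in nv nw *; rewrite (negPf nv) (negPf nw).
Qed.

Let between_val u : {subset u <= V} -> {in map val u, forall d, ~~ (v < d < w)%N}.
Proof. by move=> sub _ /mapP [c cu ->]; apply: consecutive_between; exact: sub. Qed.

Lemma inv_tuple_swap_out u : uniq u -> {subset u <= V} ->
  ~~ ((v \in u) && (w \in u)) -> inv_tuple (map (tperm v w) u) = inv_tuple u.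
Proof.
move=> uu sub nvw; rewrite /inv_tuple map_val_tperm inversions_swap_out //.
- by rewrite map_inj_uniq //; exact: val_inj.
- exact: between_val.
- by rewrite !(mem_map val_inj).
Qed.

Lemma inv_tuple_swap u : uniq u -> {subset u <= V} ->
  v \in u -> w \in u -> (index v u < index w u)%N ->
  inv_tuple (map (tperm v w) u) = (inv_tuple u).+1.
Proof.
move=> uu sub vu wu lt; rewrite /inv_tuple map_val_tperm inversions_swap //.
- by rewrite map_inj_uniq //; exact: val_inj.
- exact: between_val.
- by rewrite (mem_map val_inj).
- by rewrite (mem_map val_inj).
- by rewrite !(index_map val_inj).
Qed.

Lemma inv_tuple_swap_down u : uniq u -> {subset u <= V} ->
  v \in u -> w \in u -> (index w u < index v u)%N ->
  inv_tuple u = (inv_tuple (map (tperm v w) u)).+1.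
Proof.
move=> uu sub vu wu lt; have tinj := @perm_inj _ (tperm v w).
rewrite -inv_tuple_swap ?map_inj_uniq //.
- by rewrite (mapK (tpermK v w)).
- by move=> c; rewrite mem_map_tperm => /sub; rewrite tperm_closed.
- by rewrite mem_map_tperm tpermL.
- by rewrite mem_map_tperm tpermR.
rewrite -[X in (index X _ < _)%N](tpermR v w) -[X in (_ < index X _)%N](tpermL v w).
by rewrite !(index_map tinj).
Qed.

Lemma occurs_beforeE (P : seq 'I_n * seq 'I_n) :
  perm_eq (P.1 ++ P.2) V ->
  occurs_before V (rank v) P = (index v (P.1 ++ P.2) < index w (P.1 ++ P.2))%N.
Proof.
move=> pP; rewrite /occurs_before -rw.
have inj : {in P.1 ++ P.2 &, injective rank}.
  by move=> c d; rewrite !(perm_mem pP); exact: rank_inj.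
by rewrite !(index_map_in inj) ?(perm_mem pP).
Qed.

Lemma perm_swap (P : seq 'I_n * seq 'I_n) : perm_eq (P.1 ++ P.2) V ->
  perm_eq (map (tperm v w) P.1 ++ map (tperm v w) P.2) V.
Proof.
move=> pP; rewrite -map_cat; apply: perm_trans (perm_map _ pP) _.
apply: uniq_perm; first by rewrite map_inj_uniq ?increasing_uniq //; exact: perm_inj.
  exact: increasing_uniq.
by move=> c; rewrite mem_map_tperm tperm_closed.
Qed.

Lemma map_adj_transp u : {subset u <= V} ->
  map (adj_transp V (rank v)) u = map (tperm v w) u.
Proof. by move=> sub; apply/eq_in_map => c cu; apply: adj_transpE => //; exact: sub. Qed.

Lemma increasing_tperm B : increasing B -> {subset B <= V} -> v \in B -> w \notin B ->
  increasing (map (tperm v w) B).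
Proof.
move=> inc_B sBV vB wB; move: inc_B; rewrite /increasing !sorted_map.
apply: (sub_in_sorted (P := mem B)); last by apply/allP.
move=> y z yB zB /=.
have yw : y != w by apply: contraNneq wB => <-.
have zw : z != w by apply: contraNneq wB => <-.
have := consecutive_between (sBV _ zB); have := lt_vw.
have neq (c d : 'I_n) : c != d -> nat_of_ord c <> d by move=> /eqP cd /val_inj.
move: (neq _ _ yw) (neq _ _ zw).
case: tpermP => [->|yw'|_ _]; last 2 first.
- by rewrite yw' eqxx in yw.
- case: tpermP => [->|zw'|_ _] //; last by rewrite zw' eqxx in zw.
  by clear; lia.
case: tpermP => [->|zw'|_ _]; last 2 first.
- by rewrite zw' eqxx in zw.
- by clear; lia.
by clear; lia.
Qed.

End TowerCombinatorics.

Lemma std_step_spec n (V B : seq 'I_n) :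
  increasing V -> increasing B -> {subset B <= V} -> B != top_col V (size B) ->
  exists v w, [/\ consecutive V v w, v \in B, w \notin B, std_z V B = rank V v
                & std_step V B = map (tperm v w) B].
Proof.
move=> inc_V inc_B sBV neB.
have [v [w [vB wV wB zE rw]]] := std_z_spec inc_V inc_B sBV neB.
have vw : consecutive V v w by rewrite /consecutive sBV // wV rw eqxx.
by exists v, w; split=> //; rewrite /std_step zE (map_adj_transp vw).
Qed.

Lemma inversions_sorted (u : seq nat) : sorted ltn u -> inversions u = 0%N.
Proof.
elim: u => //= c u IHu; rewrite (path_sortedE ltn_trans) => /andP [/allP all_c su].
rewrite IHu // addn0; apply/eqP; rewrite eqn0Ngt -has_count; apply/negP.
by move=> /hasP [d du] /=; have := all_c d du; rewrite /= => /ltnW; rewrite leqNgt => /negPf ->.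
Qed.

Lemma inv_tuple_increasing n (u : seq 'I_n) : increasing u -> inv_tuple u = 0%N.
Proof. exact: inversions_sorted. Qed.

(** * Expansion along the tower *)

Section TowerExpansion.
Variables (K : comUnitRingType) (q : K) (n : nat) (R : algType K).
Variable x : 'I_n -> 'I_n -> R.
Hypothesis q_unit : q \is a GRing.unit.
Hypothesis transvection : forall a b : 'I_n, adjacent a b ->
  exists Phi : {rmorphism R -> 'M[R]_2},
  (forall i c, Phi (x i c) = transv_mx q x a b (i, c)) /\
  (forall c y i j, Phi (c *: y) i j = c *: Phi y i j).
Hypothesis x_comm : forall i j i' j' : 'I_n, (i < i')%N -> (j' < j)%N ->
  x i j * x i' j' = x i' j' * x i j.
Variables A A' : seq 'I_n.
Hypothesis lt_AA' : forall i i', i \in A -> i' \in A' -> (i < i')%N.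
Hypothesis size_AA' : (size A + size A')%N = n.
Variables (V : seq 'I_n) (C : {set 'I_n}).
Hypothesis inc_V : increasing V.
Hypothesis disj_VC : forall c, c \in V -> c \notin C.
Hypothesis size_VC : (size V + (#|C| + #|C|))%N = n.
Implicit Types (u B : seq 'I_n) (P : seq 'I_n * seq 'I_n).
Local Notation sminor := (sminor q x).

Definition cset u := [set c in u] :|: C.

(** Invariant of all pairs in the lists. The size condition fits [cset P.1] to the rows [A]; with
    [size_VC] it also fits [cset P.2] to [A']. *)
Definition split_of_V P := perm_eq (P.1 ++ P.2) V /\ (size P.1 + #|C|)%N = size A.

Lemma card_cset u : uniq u -> {subset u <= V} -> #|cset u| = (size u + #|C|)%N.
Proof.
move=> uu sub; rewrite /cset cardsU; have -> : [set c in u] :&: C = set0.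
  by apply/setP=> c; rewrite !inE; apply/negP => /andP [/sub /disj_VC /negPf ->].
by rewrite cards0 subn0 cardsE; congr (_ + _)%N; exact/card_uniqP.
Qed.

Lemma split_uniq P : split_of_V P ->
  [/\ uniq P.1, uniq P.2, {subset P.1 <= V}, {subset P.2 <= V}
    & forall c, c \in V -> (c \in P.2) = (c \notin P.1)].
Proof.
case=> pP _; have := increasing_uniq inc_V; rewrite -(perm_uniq pP) cat_uniq.
move=> /and3P [u1 /hasPn dis u2]; split=> //.
- by move=> c c1; rewrite -(perm_mem pP) mem_cat c1.
- by move=> c c2; rewrite -(perm_mem pP) mem_cat c2 orbT.
move=> c; rewrite -(perm_mem pP) mem_cat; case c2: (c \in P.2) => //.
  by rewrite (dis c c2).
by rewrite orbF => ->.
Qed.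

Lemma split_card P : split_of_V P ->
  #|cset P.1| = size A /\ #|cset P.2| = size A'.
Proof.
move=> sP; have [u1 u2 s1 s2 _] := split_uniq sP; have [pP szP] := sP.
rewrite !card_cset //; split=> //.
apply: (@addnI (size A)).
apply: etrans _ (esym size_AA'); apply: etrans _ size_VC.
by rewrite -(perm_size pP) size_cat -szP addnACA.
Qed.

(** Union and intersection do not depend on the pair, so a single operator from [exists_hecke] acts
    on all terms. *)
Lemma split_csetUI P : split_of_V P ->
  cset P.1 :|: cset P.2 = cset V /\ cset P.1 :&: cset P.2 = C.
Proof.
move=> sP; have [_ _ s1 _ P2E] := split_uniq sP; have [pP _] := sP.
split; apply/setP=> c; rewrite !inE.
  by rewrite -(perm_mem pP) mem_cat; case: (c \in P.1); case: (c \in P.2); case: (c \in C).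
case cV: (c \in V); first by rewrite P2E //; case: (c \in P.1); rewrite ?andbT.
have -> : c \in P.1 = false by apply: contraFF cV => /s1.
by case: (c \in C); rewrite ?orbT ?andbF.
Qed.

Lemma split_rev P : split_of_V P ->
  cset P.2 :|: cset P.1 = cset V /\ cset P.2 :&: cset P.1 = C.
Proof. by move=> /split_csetUI; rewrite setUC setIC. Qed.

Lemma cset_swap v w u : consecutive V v w ->
  cset (map (tperm v w) u) = swap_set v w (cset u).
Proof.
move=> /and3P [vV wV _]; apply/setP=> c; rewrite !inE mem_map_tperm; congr (_ || _).
by case: tpermP => [->|->|//]; rewrite !(negPf (disj_VC _)).
Qed.

Lemma split_swap v w P : consecutive V v w -> split_of_V P ->
  split_of_V (map (tperm v w) P.1, map (tperm v w) P.2).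
Proof. by move=> vw [pP szP]; split; rewrite /= ?size_map //; exact: perm_swap. Qed.

Definition col_term P : R :=
  (- q) ^- (inv_tuple P.1 + inv_tuple P.2) *:
    (sminor A (cset P.1) * sminor A' (cset P.2)).

(** Multiplying [(- q) ^- l.+1] by q gives [- (- q) ^- l]. This rewrites the eigenvalue of T when
    [w] precedes [v] in one tuple. *)
Let skein l : q^-1 * (- q) ^- l.+1 = (q^-1 - q) * (- q) ^- l.+1 - (- q) ^- l.
Proof.
have NqU : - q \is a GRing.unit by rewrite unitrN.
rewrite exprS invrM ?unitrX // invrN mulrBl -addrA -[LHS]addr0; congr (_ + _).
by rewrite mulrN [q * _]mulrC mulNr -mulrA mulVr // mulr1 opprK subrr.
Qed.

(** If [v] and [w] are in different tuples, the scalars are those of [exists_hecke] and no inversion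
    changes. In one tuple T acts by -q^-1: this is the effect of one new inversion if [v] comes
    first, and [skein] treats the other order. The same T serves the products with the minor on [A']
    first, since [exists_hecke] leaves the row tuples free. *)
Lemma hecke_col_term v w : consecutive V v w ->
  exists T : {linear R -> R},
  (forall P, split_of_V P ->
     T (col_term P) = col_term (map (tperm v w) P.1, map (tperm v w) P.2)
       - (if occurs_before V (rank V v) P then 0 else q^-1 - q) *: col_term P) /\
  (forall P, split_of_V P -> w \in P.1 -> v \notin P.1 ->
     T (sminor A' (cset P.2) * sminor A (cset P.1)) =
     sminor A' (cset (map (tperm v w) P.2)) * sminor A (cset (map (tperm v w) P.1))).
Proof.
move=> vw; have [vV wV _] := and3P vw; have lt_vw := consecutive_ltn inc_V vw.
have inVC c : c \in V -> c \in cset V :\: C.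
  by move=> cV; rewrite !inE cV disj_VC.
have [c /andP [vc cw] cV|T TE] := exists_hecke q_unit transvection lt_vw
    (inVC v vV) (inVC w wV).
  move: cV; rewrite !inE => /orP [cV|//].
  by have := consecutive_between inc_V vw cV; rewrite vc cw.
exists T; split=> P sP.
  have [szX szY] := split_card sP; have [XU YC] := split_csetUI sP.
  have [u1 u2 s1 s2 P2E] := split_uniq sP; have [pP _] := sP.
  have := TE _ _ _ _ szX szY XU YC.
  rewrite /col_term [T (_ *: _)]linearZ /= (occurs_beforeE vw pP) !index_cat.
  rewrite -!(cset_swap _ vw) !inE !(negPf (disj_VC _)) // !orbF.
  have vP2 := P2E v vV; have wP2 := P2E w wV.
  case v1: (v \in P.1); case w1: (w \in P.1); move: vP2 wP2; rewrite v1 w1 /= => v2 w2.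
  - case=> _ _ /(_ erefl) ->.
    have -> : cset (map (tperm v w) P.1) = cset P.1.
      by rewrite cset_swap // swap_set_id // !inE v1 w1.
    have -> : cset (map (tperm v w) P.2) = cset P.2.
      by rewrite cset_swap // swap_set_id // !inE v2 w2 !(negPf (disj_VC _)).
    rewrite (inv_tuple_swap_out inc_V vw u2 s2) ?v2 // !scalerA -scalerBl.
    congr (_ *: _); case: ltnP => [lt|ge].
      rewrite (inv_tuple_swap inc_V vw u1 s1) // mul0r subr0 addSn exprS.
      by rewrite invrM ?unitrX ?unitrN // invrN.
    rewrite (inv_tuple_swap_down inc_V vw u1 s1) //; last first.
      rewrite ltn_neqAle ge andbT; apply/eqP => /index_inj e.
      by move: lt_vw; rewrite e ?ltnn //.
    by rewrite addSn mulrN mulrC skein opprB.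
  - case=> /(_ isT isT) -> _ _; have vP : (index v P.1 < size P.1)%N by rewrite index_mem.
    rewrite (leq_trans vP) ?leq_addr // scale0r subr0.
    by rewrite !(inv_tuple_swap_out inc_V vw) ?v1 ?w1 ?v2 ?w2.
  - case=> _ /(_ isT isT) -> _; have wP : (index w P.1 < size P.1)%N by rewrite index_mem.
    rewrite ltnNge (leq_trans (ltnW wP)) ?leq_addr //= scalerBr.
    rewrite !(inv_tuple_swap_out inc_V vw) ?v1 ?w1 ?v2 ?w2 //.
    by rewrite !scalerA mulrC.
  - case=> _ _ /(_ erefl) ->.
    have -> : cset (map (tperm v w) P.1) = cset P.1.
      by rewrite cset_swap // swap_set_id // !inE v1 w1 !(negPf (disj_VC _)).
    have -> : cset (map (tperm v w) P.2) = cset P.2.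
      by rewrite cset_swap // swap_set_id // !inE v2 w2.
    rewrite (inv_tuple_swap_out inc_V vw u1 s1) ?v1 // !scalerA -scalerBl.
    rewrite ltn_add2l; congr (_ *: _); case: ltnP => [lt|ge].
      rewrite (inv_tuple_swap inc_V vw u2 s2) // mul0r subr0 addnS exprS.
      by rewrite invrM ?unitrX ?unitrN // invrN.
    rewrite (inv_tuple_swap_down inc_V vw u2 s2) //; last first.
      rewrite ltn_neqAle ge andbT; apply/eqP => /index_inj e.
      by move: lt_vw; rewrite e ?ltnn //.
    by rewrite addnS mulrN mulrC skein opprB.
move=> w1 v1; have [szX szY] := split_card sP; have [XU YC] := split_rev sP.
have [u1 u2 s1 s2 P2E] := split_uniq sP.
have [TE1 _ _] := TE _ _ _ _ szY szX XU YC.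
rewrite !(cset_swap _ vw); apply: TE1; rewrite !inE P2E //.
  by rewrite v1.
by rewrite w1 (negPf (disj_VC _)).
Qed.

(** Below the top each step transposes consecutive elements of [V], which preserves the
    invariant. *)
Lemma split_col_list s B i P :
  increasing B -> {subset B <= V} -> (size B + #|C|)%N = size A ->
  (forall t, (t < s)%N -> iter t (std_step V) B != top_col V (size B)) ->
  P \in col_list_at V s B i -> split_of_V P.
Proof.
elim: s B i P => [|s IHs] B i P inc_B sBV szB neB /=.
  case: eqP => // _; rewrite inE => /eqP ->; split=> //=.
  have uB := increasing_uniq inc_B; have uV := increasing_uniq inc_V.
  apply: uniq_perm => //.
    rewrite cat_uniq uB filter_uniq // andbT; apply/hasPn => c.
    by rewrite mem_filter => /andP [].
  move=> c; rewrite mem_cat mem_filter; case cB: (c \in B) => //=.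
  by rewrite (sBV c cB).
have [v [w [vw vB wB zE stepE]]] := std_step_spec inc_V inc_B sBV (neB 0%N isT).
have IH i' P' : P' \in col_list_at V s (std_step V B) i' -> split_of_V P'.
  apply: IHs; rewrite ?stepE ?size_map //.
  - exact: increasing_tperm inc_B sBV vB wB.
  - by move=> c; rewrite mem_map_tperm => /sBV; rewrite tperm_closed.
  - move=> t lt_t; have := neB t.+1; rewrite iterSr stepE ltnS; exact.
rewrite mem_cat => /orP [|/mapP [P' P'in ->]].
  by case: i => [//|i]; rewrite mem_filter => /andP [_ /IH].
have sP' := IH _ _ P'in; have [_ _ s1 s2 _] := split_uniq sP'.
by rewrite zE !(map_adj_transp vw) //; exact: split_swap.
Qed.

(** Induction down from the top of the tower, where the claim is [sminor_qcomm]; applying T to the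
    expansion of [std_step V B] gives that of [B]. *)
Lemma tower_expansion s B :
  increasing B -> {subset B <= V} -> (size B + #|C|)%N = size A ->
  iter s (std_step V) B = top_col V (size B) ->
  (forall t, (t < s)%N -> iter t (std_step V) B != top_col V (size B)) ->
  sminor A' (cset [seq c <- V | c \notin B]) * sminor A (cset B) =
  q ^+ #|C| *: \sum_(0 <= i < s.+1) ((-1) ^+ i * (q^-1 - q) ^+ i) *:
    \sum_(P <- col_list_at V s B i) col_term P.
Proof.
elim: s B => [|s IHs] B inc_B sBV szB topB neB.
  have sB : split_of_V (B, [seq c <- V | c \notin B]).
    by apply: (@split_col_list 0 B 0) => //=; rewrite inE.
  have [szX szY] := split_card sB; have [_ YC] := split_csetUI sB.
  rewrite big_nat1 /= big_seq1 /col_term /= !expr0 mulr1 scale1r.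
  rewrite !inv_tuple_increasing ?increasing_filter // expr0 invr1 scale1r -{1}YC.
  apply: (sminor_qcomm q_unit transvection x_comm lt_AA') => //.
    by rewrite szX szY.
  (* Separation: at the top [B] is a final segment of [V], so it lies to the right of its
     complement. *)
  move: topB => /= topB.
  move=> c d; rewrite !inE !mem_filter => /andP [+ /orP [cB|cC]]; last by rewrite cC orbT.
  move=> _ /andP [+ /orP [/andP [dB dV]|dC]]; last by rewrite dC orbT.
  move=> _; have cV := sBV c cB; rewrite -(rank_ltn inc_V) // /rank ltnS.
  have uV := increasing_uniq inc_V.
  move: cB dB; rewrite topB /top_col => cB dB.
  have := esym (cat_take_drop (size V - size B) V).
  move: (take _ V) (drop _ V) cB dB => V1 V2 cB dB eV.
  have d1 : d \in V1 by move: dV; rewrite eV mem_cat (negPf dB) orbF.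
  have c1 : c \notin V1.
    by move: uV; rewrite eV cat_uniq => /and3P [_ /hasPn dis _]; exact: dis.
  by rewrite eV !index_cat d1 (negPf c1) ltn_addr // index_mem.
have [v [w [vw vB wB zE stepE]]] := std_step_spec inc_V inc_B sBV (neB 0%N isT).
have incB' : increasing (std_step V B).
  by rewrite stepE; exact: increasing_tperm inc_B sBV vB wB.
have subB' : {subset std_step V B <= V}.
  by move=> c; rewrite stepE mem_map_tperm => /sBV; rewrite tperm_closed.
have szB' : size (std_step V B) = size B by rewrite size_map.
have neB' t : (t < s)%N ->
    iter t (std_step V) (std_step V B) != top_col V (size (std_step V B)).
  by move=> lt_t; have := neB t.+1; rewrite iterSr szB' ltnS; exact.
have topB' : iter s (std_step V) (std_step V B) = top_col V (size (std_step V B)).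
  by rewrite -iterSr topB szB'.
have szAB' : (size (std_step V B) + #|C|)%N = size A by rewrite szB'.
have [T [TP TB]] := hecke_col_term vw.
have sB' : split_of_V (std_step V B, [seq c <- V | c \notin std_step V B]).
  by apply: (@split_col_list 0 (std_step V B) 0) => //=; rewrite inE.
have wB' : w \in std_step V B by rewrite stepE mem_map_tperm tpermR.
have vB' : v \notin std_step V B by rewrite stepE mem_map_tperm tpermL.
have := TB _ sB' wB' vB'; rewrite /= (IHs _ incB' subB' szAB' topB' neB').
have -> : cset (map (tperm v w) (std_step V B)) = cset B.
  by rewrite stepE (mapK (tpermK v w)).
have -> : cset (map (tperm v w) [seq c <- V | c \notin std_step V B]) =
          cset [seq c <- V | c \notin B].
  apply/setP=> c; rewrite !inE mem_map_tperm !mem_filter stepE mem_map_tperm.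
  by rewrite tpermK tperm_closed.
move=> <-; rewrite linearZ linear_sum /=; congr (_ *: _).
pose L i := col_list_at V s (std_step V B) i.
have TL i : T (\sum_(P <- L i) col_term P) =
    \sum_(P <- L i) col_term (map (tperm v w) P.1, map (tperm v w) P.2)
    - (q^-1 - q) *: \sum_(P <- L i | ~~ occurs_before V (rank V v) P) col_term P.
  rewrite linear_sum scaler_sumr [X in _ - X]big_mkcond -sumrB /=.
  rewrite !big_seq; apply: eq_bigr => P PL; rewrite TP; last first.
    exact: (split_col_list incB' subB' szAB' neB' PL).
  by case: ifP => _; rewrite ?scale0r.
(* T keeps the transposed pairs in degree i and sends the pairs that survive the filter to degree i
   + 1, as in the recursion of [col_list_at]. *)
rewrite [RHS]big_nat_recl // [LHS](eq_bigr (fun i =>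
  ((-1) ^+ i * (q^-1 - q) ^+ i) *:
    \sum_(P <- L i) col_term (map (tperm v w) P.1, map (tperm v w) P.2)
  + ((-1) ^+ i.+1 * (q^-1 - q) ^+ i.+1) *:
    \sum_(P <- L i | ~~ occurs_before V (rank V v) P) col_term P)); last first.
  move=> i _; rewrite linearZ /= TL scalerBr scalerA; congr (_ + _).
  by rewrite -scaleNr; congr (_ *: _); rewrite !exprSr; ring.
have sumL i : \sum_(P <- [seq (map (adj_transp V (std_z V B)) P.1,
    map (adj_transp V (std_z V B)) P.2) | P <- L i]) col_term P =
    \sum_(P <- L i) col_term (map (tperm v w) P.1, map (tperm v w) P.2).
  rewrite big_map !big_seq; apply: eq_bigr => P PL.
  have sP := split_col_list incB' subB' szAB' neB' PL.
  have [_ _ s1 s2 _] := split_uniq sP.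
  by rewrite zE !(map_adj_transp vw).
rewrite big_split /= sumL.
rewrite [X in _ = _ + X](eq_bigr (fun i => ((-1) ^+ i.+1 * (q^-1 - q) ^+ i.+1) *:
    \sum_(P <- L i | ~~ occurs_before V (rank V v) P) col_term P
  + ((-1) ^+ i.+1 * (q^-1 - q) ^+ i.+1) *:
    \sum_(P <- L i.+1) col_term (map (tperm v w) P.1, map (tperm v w) P.2)));
  last first.
  by move=> i _; rewrite big_cat big_filter sumL scalerDr zE.
rewrite [in RHS]big_split /= addrCA [RHS]addrC; congr (_ + _).
(* The transposed lists have no member in the new top degree. *)
have Ls : L s.+1 = [::] by rewrite /L col_list_at_gt.
rewrite [in RHS]big_nat_recr //= Ls big_nil scaler0 addr0.
by rewrite [LHS]big_nat_recl.
Qed.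

Corollary tower_expansion_scaled s B :
  increasing B -> {subset B <= V} -> (size B + #|C|)%N = size A ->
  iter s (std_step V) B = top_col V (size B) ->
  (forall t, (t < s)%N -> iter t (std_step V) B != top_col V (size B)) ->
  q ^- #|C| *:
    (sminor A' (cset [seq c <- V | c \notin B]) * sminor A (cset B)) =
  \sum_(0 <= i < s.+1) ((-1) ^+ i * (q^-1 - q) ^+ i) *:
    \sum_(P <- col_list_at V s B i) col_term P.
Proof.
move=> inc_B sBV szB topB neB.
rewrite (tower_expansion inc_B sBV szB topB neB) scalerA.
by rewrite mulVr ?unitrX // scale1r.
Qed.

End TowerExpansion.

(** * The expansion in the quantum matrix algebra *)

Theorem mainTheorem3 (k : fieldType) (r s : nat)
    (I : r.-tuple 'I_(r + s)) (J : s.-tuple 'I_(r + s)) :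
  increasing I -> increasing J ->
  let q := qvar k in
  let C := [seq c <- I | c \in J] in
  let V := [seq v <- ord_union I J | v \notin C] in
  let B := [seq b <- I | b \notin C] in
  let rows_r := [seq lshift s i | i <- enum 'I_r] in
  let rows_s := [seq rshift r i | i <- enum 'I_s] in
  q ^- size C *: (qminor k rows_s J * qminor k rows_r I) =
  \sum_(0 <= i < (intc V B).+1)
    ((-1) ^+ i * (q^-1 - q) ^+ i) *:
      \sum_(P <- col_list V B i)
        (- q) ^- (inv_tuple P.1 + inv_tuple P.2) *:
          (qminor k rows_r (ord_union P.1 C) * qminor k rows_s (ord_union P.2 C)).
Proof.
move=> inc_I inc_J q C V B rows_r rows_s.
have enumE : enum 'I_(r + s) = enum [set: 'I_(r + s)].
  by apply: eq_enum => i; rewrite !inE.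
have inc_union u (v : seq 'I_(r + s)) : increasing (ord_union u v).
  by rewrite /ord_union enumE; apply: increasing_filter; exact: enum_increasing.
have inc_V : increasing V by exact: increasing_filter.
have inc_B : increasing B by exact: increasing_filter.
have uI := increasing_uniq inc_I; have uJ := increasing_uniq inc_J.
have uC : uniq C by exact: filter_uniq.
have memC c : (c \in C) = (c \in I) && (c \in J) by rewrite mem_filter andbC.
have memV c : (c \in V) = (c \notin C) && ((c \in I) || (c \in J)).
  by rewrite mem_filter [c \in ord_union _ _]mem_filter mem_enum andbT.
have memB c : (c \in B) = (c \notin C) && (c \in I) by rewrite mem_filter.
have sBV : {subset B <= V} by move=> c; rewrite memB memV => /andP [-> ->].
pose CS := [set c in C].
have cardC : #|CS| = size C by rewrite cardsE; apply/card_uniqP.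
have disj c : c \in V -> c \notin CS by rewrite memV inE => /andP [].
have size_rows_r : size rows_r = r by rewrite size_map size_enum_ord.
have size_rows_s : size rows_s = s by rewrite size_map size_enum_ord.
have size_rows : (size rows_r + size rows_s)%N = (r + s)%N.
  by rewrite size_rows_r size_rows_s.
have lt_rows i i' : i \in rows_r -> i' \in rows_s -> (i < i')%N.
  move=> /mapP [j _ ->] /mapP [j' _ ->] /=.
  by apply: leq_trans (ltn_ord j) _; exact: leq_addr.
have szB : (size B + #|CS|)%N = size rows_r.
  rewrite cardC size_rows_r; apply: etrans _ (size_tuple I).
  rewrite addnC -(count_predC (mem J) I) !size_filter; congr (_ + _)%N.
  by apply: eq_in_count => c cI; rewrite /= memC cI.
have cardI : #|[set c in I]| = r by rewrite cardsE (card_uniqP uI) size_tuple.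
have cardJ : #|[set c in J]| = s by rewrite cardsE (card_uniqP uJ) size_tuple.
(* Inclusion-exclusion for [I] and [J], whose union is the disjoint union of [V] and [C]. *)
have sizeV : (size V + (#|CS| + #|CS|))%N = (r + s)%N.
  have IJ : [set c in I] :&: [set c in J] = CS.
    by apply/setP=> c; rewrite !inE memC.
  have := cardsUI [set c in I] [set c in J]; rewrite IJ cardI cardJ.
  apply: etrans; rewrite addnA; congr (_ + _)%N.
  have -> : size V = #|[set c in V]|.
    by rewrite cardsE; apply/esym/card_uniqP; exact: increasing_uniq.
  have VC0 : [set c in V] :&: CS = set0.
    by apply/setP=> c; rewrite !inE memV; case: (c \in C); rewrite ?andbF.
  rewrite -cardsUI VC0 cards0 addn0; apply: eq_card => c.
  by rewrite !inE memV memC; case: (c \in I); case: (c \in J).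
have rankB : sorted ltn (map (rank V) B).
  move: inc_B; rewrite /increasing !sorted_map.
  apply: (sub_in_sorted (P := mem B)); last by apply/allP.
  by move=> c d cB dB /=; rewrite rank_ltn ?sBV.
(* The tower reaches its top after exactly [intc V B] steps, which gives both conditions on the
   iterates. *)
have [topB neB] := intcP (increasing_uniq inc_V) sBV rankB.
have := tower_expansion_scaled (qvar_unit k) (@qmat_transvection k (r + s))
  (@xgen_comm k (r + s)) lt_rows size_rows inc_V disj sizeV inc_B sBV szB topB neB.
have csetI : enum (cset CS B) = I.
  apply: increasing_eq => [||c]; [exact: enum_increasing|exact: inc_I|].
  rewrite mem_enum !inE memB memC.
  by case: (c \in I); case: (c \in J); rewrite ?orbT ?andbF.
have csetJ : enum (cset CS [seq c <- V | c \notin B]) = J.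
  apply: increasing_eq => [||c]; [exact: enum_increasing|exact: inc_J|].
  rewrite mem_enum !inE mem_filter memB memV memC.
  by case: (c \in I); case: (c \in J); rewrite ?orbT ?andbF.
have csetE u : enum (cset CS u) = ord_union u C.
  apply: increasing_eq => [||c]; [exact: enum_increasing|exact: inc_union|].
  by rewrite [c \in ord_union _ _]mem_filter !mem_enum andbT !inE.
rewrite cardC /sminor csetI csetJ => expansion.
have qminorE A0 B0 :
  qminor k A0 B0 = minor (qvar k) (@xgen k (r + s)) A0 B0 by [].
apply: (etrans expansion); apply: eq_bigr => i _.
apply: (congr1 (fun y => _ *: y)); apply: eq_bigr => P _.
by rewrite !qminorE -!csetE.
Qed.
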